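(* Let $K>0$ and fix $t>0$. Let ${\bf w}_N={\bf w}_N(t)=(w_1,\dots,w_N)$, $N=1,2,\dots$, be random vectors in $\mathbb Z^N$ satisfying Assumptions (A1), (A2), (A3) stated in the context, with parameters $\lambda_i$, $\omega_i=\lambda_i-\lambda_{i-1}$ and continuous limit function $w(t,\cdot)$. For $\omega\in\mathbb R$ define the probability mass function $\mu_K^\infty[\omega]$ on $\mathbb Z$ by $$\mu_K^\infty[\omega](n)=\int_0^1\mu_K[\omega,\lambda](n)\,d\lambda=\exp\left(-\frac K2(n-\omega)^2\right)\int_0^1 Q_K(n,\omega,\lambda)\,d\lambda .$$ Let $x\in[0,1]$ be such that $w(t,x)$ is irrational. Then there exist constants $C_{N,\epsilon}$ (not depending on $n$) with $C_{N,\epsilon}\to0$ as $N\to\infty$, $\epsilon\to0$, such that $$\left|\frac{1}{2N\epsilon}\sum_{i\in N(x\pm\epsilon)}\mu_K[\omega_i,\lambda_i](n)-\mu_K^\infty\left[\mathbb E\,\overline{\bf w}_{N(x\pm\epsilon)}\right](n)\right|\le C_{N,\epsilon}\exp\left(-Kn^2/3\right)\qquad\text{for all } n\in\mathbb Z .$$ Consequently, letting $p$ be the probability mass function on $\mathbb Z$ with $p(n)\propto\exp(-Kn^2/3)$, for every $f\in L^1(p)$ one has $$\mathbb E\left[\frac1{2N\epsilon}\sum_{i\in N(x\pm\epsilon)}f(w_i)\right]-\hat f\left(\mathbb E\,\overline{\bf w}_{N(x\pm\epsilon)}\right)\to0\quad\text{as } N\to\infty,\ \epsilon\to0,\qquad\text{where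 }\hat f(\omega)=\mu_K^\infty[\omega](f):=\sum_{n\in\mathbb Z}f(n)\mu_K^\infty[\omega](n).$$
   Context: Notation. $[0,1]$ denotes the unit torus, and lattice indices in $\{1,\dots,N\}$ are taken modulo $N$. The dependence of $w_i,\lambda_i,\omega_i$ on $N$ and $t$ is suppressed. For $x\in[0,1]$ and $\epsilon>0$, $i\in N(x\pm\epsilon)$ means that $i$ is an integer with $|i-Nx|<N\epsilon$, and $\overline{\bf w}_{N(x\pm\epsilon)}=\frac1{2N\epsilon}\sum_{i\in N(x\pm\epsilon)}w_i$. A quantity $a_{N,\epsilon}$ tends to $0$ ''as $N\to\infty$, $\epsilon\to0$'' (first $N\to\infty$, then $\epsilon\to0$) if $\limsup_{\epsilon\to0}\limsup_{N\to\infty}|a_{N,\epsilon}|=0$. The measures $\mu_K$. For $K>0$ and $\lambda\in\mathbb R$ let $\mathcal Z_K(\lambda)=\sum_{m\in\mathbb Z}e^{-K(m-\lambda)^2}$ and let $\rho_K[\lambda]$ be the probability mass function on $\mathbb Z$ given by $\rho_K[\lambda](n)=e^{-K(n-\lambda)^2}/\mathcal Z_K(\lambda)$. For $\omega,\lambda\in\mathbb R$, $\mu_K[\omega,\lambda]$ is the law of $Z-Z'$ where $Z'\sim\rho_K[\lambda-\omega]$ and $Z\sim\rho_K[\lambda]$ are independent; explicitly $$\mu_K[\omega,\lambda](n)=\exp\left(-\frac K2(n-\omega)^2\right)Q_K(n,\omega,\lambda),\qquad Q_K(n,\omega,\lambda)=\frac{\mathcal Z_{2K}\left(\lambda-\frac12[\omega+n]\right)}{\mathcal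 Z_K(\lambda-\omega)\,\mathcal Z_K(\lambda)} .$$ Assumptions (for the fixed $t$). (A1) There is $N_0$ such that for all $N>N_0$ there exist real numbers $\lambda_i$, $i=1,\dots,N$, with $\mathrm{Law}(w_i)=\mu_K[\omega_i,\lambda_i]$ for all $i=1,\dots,N$, where $\omega_i:=\lambda_i-\lambda_{i-1}$. (A2) For each $x$ there is a finite constant $C=C(t,x)$ such that $\limsup_{\epsilon\to0}\limsup_{N\to\infty}\max_{i\in N(x\pm\epsilon)}N|\omega_{i+1}-\omega_i|<C$. (A3) There is a continuous function $w(t,\cdot):[0,1]\to\mathbb R$ such that $\lim_{\epsilon\to0}\lim_{N\to\infty}\mathbb E\,\overline{\bf w}_{N(x\pm\epsilon)}=w(t,x)$ for all $x$. *)

(* Defs.v *)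
From HB Require Import structures.
From mathcomp Require Import all_boot all_order all_algebra.
From mathcomp Require Import all_classical all_reals all_analysis.
From mathcomp Require Import ring.

Set Implicit Arguments.
Unset Strict Implicit.
Unset Printing Implicit Defensive.
Import Order.TTheory GRing.Theory Num.Theory.
Import numFieldNormedType.Exports.
Local Open Scope classical_set_scope.
Local Open Scope ring_scope.

Section Measures.
Context {R : realType}.
Implicit Types (K omega lam : R) (n m : int).

Definition partition_fun K lam : R :=
  fine (\esum_(m in [set: int]) (expR (- K * (m%:~R - lam) ^+ 2))%:E)%E.

Definition rho K lam n : R :=
  expR (- K * (n%:~R - lam) ^+ 2) / partition_fun K lam.

(* Probability mass function of Z - Z' for independent Z' ~ rho K (lam - omega)
   and Z ~ rho K lam: sum over the value m of Z'. *)
Definition mu K omega lam n : R :=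
  fine (\esum_(m in [set: int])
          (rho K (lam - omega) m * rho K lam (m + n))%:E)%E.

Definition Q K n omega lam : R :=
  partition_fun (2 * K) (lam - 2^-1 * (omega + n%:~R)) /
  (partition_fun K (lam - omega) * partition_fun K lam).

Definition mu_inf K omega n : R :=
  \int[lebesgue_measure]_(lam in `[0, 1]) mu K omega lam n.

(* mu_inf K omega applied to f; meant for absolutely summable f * mu_inf, and
   then the difference of two finite sums. *)
Definition mu_inf_mean K (f : int -> R) omega : \bar R :=
  let F n := (f n * mu_inf K omega n)%:E in
  (\esum_(n in [set: int]) F^\+ n - \esum_(n in [set: int]) F^\- n)%E.

Definition gauss_third K n : R :=
  expR (- K * n%:~R ^+ 2 / 3) /
  fine (\esum_(m in [set: int]) (expR (- K * m%:~R ^+ 2 / 3))%:E)%E.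

Definition L1_gauss_third K (f : int -> R) : Prop :=
  summable [set: int] (fun n => (f n * gauss_third K n)%:E).

End Measures.

Section Lattice.
Context {R : realType}.

(* A family indexed by {1, ..., N} modulo N is encoded as an N-periodic
   function on int. *)
Definition lattice_periodic (N : nat) (A : Type) (u : int -> A) : Prop :=
  forall i : int, u (i + N%:Z) = u i.

Definition increment (lam : int -> R) (i : int) : R := lam i - lam (i - 1).

Definition sites (N : nat) (x e : R) : set int :=
  [set i : int | `|i%:~R - N%:R * x| < N%:R * e].

Definition block_avg (N : nat) (x e : R) (u : int -> R) : R :=
  (2 * N%:R * e)^-1 * \sum_(i \in sites N x e) u i.

Definition block_mean d (Om : measurableType d) (P : probability Om R)
    (N : nat) (w : int -> Om -> int) (x e : R) : R :=
  fine ('E_P[fun om => block_avg N x e (fun i => (w i om)%:~R)])%E.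

(* lim sup as e -> 0+ of the lim sup as N -> oo *)
Definition limsup2 (a : nat -> R -> \bar R) : \bar R :=
  limf_esup (fun e : R => limn_esup (fun N => a N e)) 0^'+.

Definition vanishes (a : nat -> R -> \bar R) : Prop :=
  limsup2 (fun N e => `|a N e|%E) = 0%E.

End Lattice.

Section ExplicitForm.
Context {R : realType}.

Lemma fine_esumZl (c : R) (a : int -> R) : 0 <= c -> (forall m, 0 <= a m) ->
  fine (\esum_(m in [set: int]) (c * a m)%:E)%E =
  c * fine (\esum_(m in [set: int]) (a m)%:E)%E.
Proof.
move=> c0 a0.
have -> : (\esum_(m in [set: int]) (c * a m)%:E =
           c%:E * \esum_(m in [set: int]) (a m)%:E)%E.
  rewrite /esum -ereal_supZl //; last first.
    by apply/set0P; exists (\sum_(x \in set0) (a x)%:E)%E, set0 => //.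
  congr ereal_sup; rewrite -[RHS]/((fun x => (c%:E * x)%E) @` _) image_comp.
  apply: eq_imagel => X _ /=; by rewrite ge0_mule_fsumr // => m; rewrite lee_fin.
have := esum_ge0 (S := [set: int]) (a := fun m => (a m)%:E) (fun m _ => a0 m).
case: (esum _ _) => [r _|_|//]; first by [].
have [->|cn0] := eqVneq c 0; first by rewrite mul0e mul0r.
by rewrite gt0_muley ?mulr0// lte_fin lt_neqAle eq_sym cn0.
Qed.

(* Completing the square. *)
Lemma muE (K omega lam : R) (n : int) :
  mu K omega lam n = expR (- (K / 2) * (n%:~R - omega) ^+ 2) * Q K n omega lam.
Proof.
rewrite /mu /rho /Q.
set Z1 := partition_fun K (lam - omega); set Z2 := partition_fun K lam.
have Z0 k l : 0 <= partition_fun k l :> R.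
  by apply: fine_ge0; apply: esum_ge0 => m _; rewrite lee_fin expR_ge0.
set c := expR _; set l := lam - 2^-1 * _.
transitivity (fine (\esum_(m in [set: int])
   (c / (Z1 * Z2) * expR (- (2 * K) * (m%:~R - l) ^+ 2))%:E)%E); last first.
  have d0 : 0 <= c / (Z1 * Z2) by rewrite divr_ge0 ?mulr_ge0 ?expR_ge0 ?Z0.
  rewrite (fine_esumZl d0) => [|m]; last exact: expR_ge0.
  by rewrite -/(partition_fun (2 * K) l) -[LHS]mulrA; congr (_ * _); rewrite mulrC.
congr fine; apply: eq_esum => m _; congr EFin.
rewrite mulrACA -invfM -expRD mulrAC -expRD /l; congr (expR _ / _).
by rewrite intrD; field.
Qed.

End ExplicitForm.

(* Main.v *)
Require Import Defs.
From HB Require Import structures.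
From mathcomp Require Import all_boot all_order all_algebra.
From mathcomp Require Import all_classical all_reals all_analysis.
From mathcomp Require Import measurable_realfun ring lra zify.

Set Implicit Arguments.
Unset Strict Implicit.
Unset Printing Implicit Defensive.
Import Order.TTheory GRing.Theory Num.Theory.
Import numFieldNormedType.Exports.
Local Open Scope classical_set_scope.
Local Open Scope ring_scope.

(** Near the macroscopic point x, the parameters lam_i behave like the orbit of a
rotation of the circle by the irrational angle W = w(t, x), and mu K omega lam is
1-periodic in lam. Averaging over a block of sites therefore amounts to averaging
over lam in [0, 1].

The increments omega_i are first shown to be close to W on a whole block. A
variable of law mu K omega_i lam_i is a difference of independent discrete
Gaussian variables with parameters lam_i and lam_(i-1), so its mean is
omega_i + bias lam_i - bias lam_(i-1) for a bounded function [bias] ([mu_bias],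
[bias_bounded]). In the block mean the biases telescope to two boundary terms, and
the bound on second differences makes omega_i vary by O(e) on a block. Hence every
omega_i of the block is close to the block mean ([block_increment_dist]), which
tends to W.

The equidistribution of lam_i modulo 1 is then proved by a quantitative and
elementary argument. Since W is irrational, there are fractions p/q in lowest
terms with q large and |q W - p| small ([irrational_approx]). During q consecutive
steps lam_i stays close to the orbit of the rotation by p/q, which is a translate
of the grid of q-th parts of the circle; the sum of a Lipschitz periodic function
over these q points is a Riemann sum of its integral ([rational_orbit_dist],
[drift_equidistribution]).

This is applied to lam |-> mu K m lam n, where m is the block mean. The bounds
and Lipschitz constants of mu are at most a constant times exp(- K n^2 / 3),
uniformly in n ([mu_reg]); since the equidistribution estimate is linear in these
constants, the weight factors out and the error is uniform in n ([block_mu_dist],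
[pmf_error_near]). The convergence of the means of f follows by summing the
estimate for the probability mass functions against |f|
([block_expectation_dist]). *)

(** * Sums of non-negative terms over the integers *)

Section ZSum.
Context {R : realType}.
Implicit Types (a b : int -> R).

Definition zsum a : R := fine (\esum_(m in [set: int]) (a m)%:E)%E.

Definition zfin a : Prop := (\esum_(m in [set: int]) (a m)%:E < +oo)%E.

Lemma zsumE a : (forall m, 0 <= a m) -> zfin a ->
  (\esum_(m in [set: int]) (a m)%:E)%E = (zsum a)%:E.
Proof.
move=> a0 fa; rewrite /zsum fineK// ge0_fin_numE//.
by apply: esum_ge0 => m _; rewrite lee_fin.
Qed.

Lemma zsum_ge0 a : (forall m, 0 <= a m) -> 0 <= zsum a.
Proof. by move=> a0; apply/fine_ge0/esum_ge0 => m _; rewrite lee_fin. Qed.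

Lemma zfin_le a b : (forall m, a m <= b m) -> zfin b -> zfin a.
Proof. by move=> ab; apply: le_lt_trans; apply: le_esum => m _; rewrite lee_fin. Qed.

Lemma zsum_le a b : (forall m, 0 <= a m) -> (forall m, a m <= b m) -> zfin b ->
  zsum a <= zsum b.
Proof.
move=> a0 ab fb; rewrite -lee_fin -!zsumE//.
- by apply: le_esum => m _; rewrite lee_fin.
- by move=> m; exact: le_trans (ab m).
- exact: zfin_le fb.
Qed.

Lemma zfinD a b : (forall m, 0 <= a m) -> (forall m, 0 <= b m) ->
  zfin a -> zfin b -> zfin (fun m => a m + b m).
Proof.
move=> a0 b0 fa fb; rewrite /zfin.
under eq_esum do rewrite EFinD.
rewrite esumD => [|m _|m _]; rewrite ?lee_fin//.
by rewrite lte_add_pinfty.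
Qed.

Lemma zsumD a b : (forall m, 0 <= a m) -> (forall m, 0 <= b m) ->
  zfin a -> zfin b -> zsum (fun m => a m + b m) = zsum a + zsum b.
Proof.
move=> a0 b0 fa fb; apply: EFin_inj; rewrite -zsumE; last first.
- exact: zfinD.
- by move=> m; rewrite addr_ge0.
under eq_esum do rewrite EFinD.
rewrite esumD => [|m _|m _]; rewrite ?lee_fin//.
by rewrite !zsumE.
Qed.

Lemma zsumZl c a : 0 <= c -> (forall m, 0 <= a m) ->
  zsum (fun m => c * a m) = c * zsum a.
Proof. exact: fine_esumZl. Qed.

Lemma zfinZl c a : 0 <= c -> (forall m, 0 <= a m) -> zfin a ->
  zfin (fun m => c * a m).
Proof.
move=> c0 a0 fa; have fn (n : nat) : zfin (fun m => n%:R * a m).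
  elim: n => [|n IH].
    by under eq_fun do rewrite mul0r; rewrite /zfin esum1.
  under eq_fun do rewrite -natr1 mulrDl mul1r.
  by apply: zfinD => // m; rewrite mulr_ge0.
apply: zfin_le (fn (absz (Num.ceil c))) => m; rewrite ler_wpM2r//.
by rewrite pmulrn gez0_abs ?ceil_ge// ceil_ge0 (lt_le_trans (ltrN10 _)).
Qed.

Lemma esumZl_zsum c a : 0 <= c -> (forall m, 0 <= a m) -> zfin a ->
  (\esum_(m in [set: int]) (c * a m)%:E = (c * zsum a)%:E)%E.
Proof.
move=> c0 a0 fa; rewrite -zsumZl// zsumE//; first by move=> m; rewrite mulr_ge0.
exact: zfinZl.
Qed.

Lemma esum_int_reindex (f g : int -> int) (a : int -> \bar R) :
  cancel f g -> cancel g f ->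
  (\esum_(m in [set: int]) a (f m) = \esum_(m in [set: int]) a m)%E.
Proof.
move=> fg gf; rewrite [RHS](reindex_esum [set: int] _ f)//.
split=> //; first by move=> x y _ _ /(can_inj fg).
by move=> y _; exists (g y).
Qed.

Lemma zsum_shift c a : zsum (fun m => a (m + c)) = zsum a.
Proof.
rewrite /zsum (@esum_int_reindex (fun m => m + c) (fun m => m - c) (fun m => (a m)%:E))//.
- by move=> m; rewrite addrK.
- by move=> m; rewrite subrK.
Qed.

Lemma zsum_ge_term a m : (forall m, 0 <= a m) -> zfin a -> a m <= zsum a.
Proof.
move=> a0 fa; rewrite -lee_fin -zsumE//.
by rewrite (esumID [set m])// ?setI1 ?mem_set ?esum_set1 ?leeDl ?lee_fin// => *;
  rewrite ?esum_ge0// => *; rewrite lee_fin.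
Qed.

(** Each sum is bounded by the other one plus the sum of the errors, so that no
sum of terms of varying sign is ever formed. *)
Lemma zsum_dist a b c : (forall m, 0 <= a m) -> (forall m, 0 <= b m) ->
  (forall m, `|a m - b m| <= c m) -> zfin a -> zfin b -> zfin c ->
  `|zsum a - zsum b| <= zsum c.
Proof.
move=> a0 b0 abc fa fb fc.
have c0 m : 0 <= c m by exact: le_trans (abc m).
have ab m : a m <= b m + c m.
  by rewrite -lerBlDl; exact: le_trans (ler_norm _) (abc m).
have ba m : b m <= a m + c m.
  by rewrite -lerBlDl; apply: le_trans (abc m); rewrite distrC ler_norm.
have := zsum_le a0 ab (zfinD b0 c0 fb fc); rewrite zsumD//.
have := zsum_le b0 ba (zfinD a0 c0 fa fc); rewrite zsumD//.
by move=> h1 h2; rewrite ler_norml; lra.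
Qed.

(** A geometric series on each half line. *)
Lemma zfin_expRN_norm (k : R) : 0 < k -> zfin (fun m => expR (- k * `|m%:~R|)).
Proof.
move=> k0; rewrite /zfin.
set r := expR (- k).
have r1 : r < 1 by rewrite /r expR_lt1 oppr_lt0.
have r0 : 0 < r by exact: expR_gt0.
have geo (c : nat -> R) : (forall i, 0 <= c i <= r ^+ i) ->
    (\esum_(i in [set: nat]) (c i)%:E < +oo)%E.
  move=> c0; apply: (@le_lt_trans _ _ (1 - r)^-1%:E); last exact: ltry.
  rewrite -nneseries_esumT; last by move=> i; rewrite lee_fin; case/andP: (c0 i).
  apply: lime_le.
    by apply: is_cvg_nneseries => i _ _; rewrite lee_fin; case/andP: (c0 i).
  apply: nearW => n; rewrite sumEFin lee_fin.
  apply: (@le_trans _ _ (\sum_(0 <= i < n) r ^+ i)).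
    by apply: ler_sum => i _; case/andP: (c0 i).
  rewrite big_mkord.
  have -> : \sum_(i < n) r ^+ i = (1 - r ^+ n) / (1 - r).
    apply: (canRL (mulfK _)); first by rewrite lt0r_neq0// subr_gt0.
    by rewrite mulrC -[1 - r]opprB mulNr -subrX1 opprB.
  rewrite -[leRHS]mul1r ler_wpM2r ?invr_ge0 ?subr_ge0 ?(ltW r1)//.
  by rewrite gerBl exprn_ge0// ltW.
rewrite (esumID (range Posz))/=; last by move=> *; rewrite lee_fin expR_ge0.
have -> : [set: int] `&` ~` range Posz = range Negz.
  apply/seteqP; split => [[m|m] [_ h]|_ [m _ <-]] /=.
  - by case: h; exists m.
  - by exists m.
  - by split => // -[].
rewrite setTI !esum_image; try by move=> ? ? _ _ [].
apply: lte_add_pinfty; apply: geo => i; rewrite expR_ge0/=.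
  by rewrite -pmulrn normr_nat /r -expRM_natr.
rewrite NegzE mulrNz normrN -pmulrn normr_nat /r -expRM_natr ler_expR.
by rewrite -[i.+1%:R]natr1 mulrDr mulr1 gerDl oppr_le0 ltW.
Qed.

Lemma zfin_gauss (k : R) : 0 < k -> zfin (fun m => expR (- k * m%:~R ^+ 2)).
Proof.
move=> k0; apply: zfin_le (zfin_expRN_norm k0) => m.
rewrite ler_expR ler_nM2l ?oppr_lt0// -real_normK ?num_real//.
rewrite -intr_norm -rmorphXn/= ler_int.
by case: `|m| (normr_ge0 m) => // -[//|n] _; rewrite expr2 ler_peMr.
Qed.

End ZSum.

(** * Gaussians with a moving centre *)

Section GaussLip.
Context {R : realType}.

(** Convexity bounds the difference quotient of the exponential by its larger end
value; the sum of both values makes the bound symmetric. *)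
Lemma dist_expR (u v : R) : `|expR u - expR v| <= `|u - v| * (expR u + expR v).
Proof.
have key (x y : R) : expR x - expR y <= `|x - y| * (expR x + expR y).
  apply: (@le_trans _ _ (expR x * (x - y))).
    have := expR_ge1Dx (y - x) => h.
    have -> : expR y = expR x * expR (y - x) by rewrite -expRD; congr expR; ring.
    have := expR_gt0 x; nra.
  have := expR_gt0 x; have := expR_gt0 y; have := ler_norm (x - y); have := normr_ge0 (x - y).
  nra.
rewrite ler_norml key andbT.
have := key v u; rewrite distrC addrC; lra.
Qed.

(** Giving up a third of the exponent pays twice: one sixth absorbs the cross term
2 n y when the centre moves from 0 to y, the other sixth absorbs the factor
linear in n that differentiation in y produces. *)
Lemma gauss_recenter (k M : R) : 0 < k -> 0 <= M ->
  exists2 C, 0 <= C & forall n y y' : R, `|y| <= M -> `|y'| <= M ->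
    expR (- k * (n - y) ^+ 2) <= C * expR (- (2 / 3 * k) * n ^+ 2) /\
    `|expR (- k * (n - y) ^+ 2) - expR (- k * (n - y') ^+ 2)| <=
      C * `|y - y'| * expR (- (2 / 3 * k) * n ^+ 2).
Proof.
move=> k0 M0.
(* (n - y)^2 >= 5/6 n^2 - 5 y^2, since the difference is (n - 6 y)^2 / 6 *)
have bd (n y : R) : `|y| <= M ->
    expR (- k * (n - y) ^+ 2) <= expR (5 * k * M ^+ 2) * expR (- (5 / 6 * k) * n ^+ 2).
  move=> yM; rewrite -expRD ler_expR.
  have y2 : y ^+ 2 <= M ^+ 2 by rewrite -real_normK ?num_real// lerXn2r ?nnegrE.
  have := sqr_ge0 (n - 6 * y); nra.
set D := expR (5 * k * M ^+ 2).
have D0 : 0 < D by exact: expR_gt0.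
(* |n| <= 1 + n^2, and n^2 is absorbed by k n^2 / 6 <= e^(k n^2 / 6) *)
have lin (n : R) : (2 * `|n| + 2 * M) * expR (- (5 / 6 * k) * n ^+ 2) <=
    (1 + 2 * M + 6 / k) * expR (- (2 / 3 * k) * n ^+ 2).
  have -> : - (2 / 3 * k) * n ^+ 2 = - (5 / 6 * k) * n ^+ 2 + k / 6 * n ^+ 2 by field.
  rewrite expRD [leRHS]mulrCA [leLHS]mulrC ler_pM2l ?expR_gt0//.
  have h := expR_ge1Dx (k / 6 * n ^+ 2).
  have k6 : 6 / k * (k / 6 * n ^+ 2) = n ^+ 2 by field; rewrite gt_eqF.
  have i0 : 0 < 6 / k by rewrite divr_gt0.
  have n2 : `|n| ^+ 2 = n ^+ 2 by rewrite real_normK ?num_real.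
  set E := expR _ in h *; set X := k / 6 * n ^+ 2 in h k6.
  have X0 : 0 <= X by rewrite mulr_ge0 ?sqr_ge0 ?divr_ge0// ltW.
  have := sqr_ge0 (`|n| - 1); nra.
exists (D + 2 * k * D * (1 + 2 * M + 6 / k)).
  by rewrite addr_ge0 ?mulr_ge0 ?addr_ge0 ?divr_ge0// ?mulr_ge0// ltW.
have sl : 0 <= 2 * k * D * (1 + 2 * M + 6 / k).
  by rewrite ?mulr_ge0 ?addr_ge0 ?divr_ge0// ?mulr_ge0// ltW.
move=> n y y' yM y'M; split.
  apply: le_trans (bd n y yM) _; apply: ler_pM; rewrite ?expR_ge0//.
    by rewrite lerDl.
  by rewrite ler_expR; have := sqr_ge0 n; nra.
apply: le_trans (dist_expR _ _) _.
have -> : - k * (n - y) ^+ 2 - - k * (n - y') ^+ 2 = k * ((y - y') * (2 * n - (y + y'))) by ring.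
rewrite !normrM (gtr0_norm k0).
have l1 : `|2 * n - (y + y')| <= 2 * `|n| + 2 * M.
  apply: le_trans (ler_normB _ _) _; rewrite normrM (@gtr0_norm _ 2)// lerD2l.
  by apply: le_trans (ler_normD _ _) _; lra.
have := bd n y yM; have := bd n y' y'M; rewrite -/D.
have := lin n.
set E5 := expR (- (5 / 6 * k) * _); set E3 := expR (- (2 / 3 * k) * _) => l2 b2 b1.
have E30 : 0 < E3 := expR_gt0 _.
have ny := normr_ge0 (y - y').
apply: (@le_trans _ _ (`|y - y'| * (2 * k * D) * ((2 * `|n| + 2 * M) * E5))).
  rewrite [leRHS](_ : _ = (k * (`|y - y'| * (2 * `|n| + 2 * M))) * (D * E5 + D * E5)); last by ring.
  apply: ler_pM; rewrite ?addr_ge0 ?expR_ge0//.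
  - by rewrite !mulr_ge0// ltW.
  - by rewrite ler_pM2l// ler_wpM2l.
  - exact: lerD.
apply: (@le_trans _ _ (`|y - y'| * (2 * k * D) * ((1 + 2 * M + 6 / k) * E3))).
  by rewrite ler_wpM2l// !mulr_ge0// ltW.
rewrite [leLHS](_ : _ = 2 * k * D * (1 + 2 * M + 6 / k) * `|y - y'| * E3); last by ring.
by rewrite ler_pM2r// ler_wpM2r// lerDr ltW.
Qed.

End GaussLip.

(** * The partition function *)

Section PartitionFun.
Context {R : realType}.
Implicit Types (k lam : R).

Lemma zfin_gauss_at k lam : 0 < k ->
  zfin (fun m => expR (- k * (m%:~R - lam) ^+ 2)).
Proof.
move=> k0; have [C C0 hC] := gauss_recenter k0 (normr_ge0 lam).
apply: (@zfin_le _ _ (fun m => C * expR (- (2 / 3 * k) * m%:~R ^+ 2))).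
  by move=> m; exact: (hC m%:~R lam lam _ _).1.
apply: zfinZl => //.
by apply: zfin_gauss; rewrite mulr_gt0// divr_gt0.
Qed.

Lemma partition_fun_periodic k lam (c : int) :
  partition_fun k (lam + c%:~R) = partition_fun k lam.
Proof.
set a := fun m : int => expR (- k * (m%:~R - lam) ^+ 2).
transitivity (zsum (fun m => a (m - c))); last exact: (zsum_shift (- c) a).
congr fine; apply: eq_esum => m _.
rewrite /a; congr (expR (_ * _ ^+ 2))%:E.
by rewrite intrD rmorphN/=; ring.
Qed.

(** The term of the integer part of lam alone reaches the bound. *)
Lemma partition_fun_ge k lam : 0 < k -> expR (- k) <= partition_fun k lam.
Proof.
move=> k0; apply: le_trans (zsum_ge_term (Num.floor lam) _ (zfin_gauss_at lam k0)); last first.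
  by move=> m; exact: expR_ge0.
rewrite ler_expR mulNr lerN2 -[leRHS]mulr1 ler_pM2l//.
have := floor_le_tmp lam; have := floorD1_gt lam; rewrite intrD.
nra.
Qed.

Lemma partition_fun_gt0 k lam : 0 < k -> 0 < partition_fun k lam.
Proof. by move=> k0; apply: lt_le_trans (partition_fun_ge lam k0); exact: expR_gt0. Qed.

(** By periodicity it is enough to let the centres vary in a compact set, where
all the Gaussians are dominated by a single summable one. At distance at least 1
the Lipschitz bound follows from boundedness, and at smaller distance both
centres are moved to the compact set by the same translation. *)
Lemma partition_fun_reg k : 0 < k -> exists2 C, 0 <= C &
  (forall lam, partition_fun k lam <= C) /\
  forall lam lam', `|partition_fun k lam - partition_fun k lam'| <= C * `|lam - lam'|.
Proof.
move=> k0; have [C C0 hC] := @gauss_recenter R k 3 k0 ltac:(by []).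
set g := fun m : int => expR (- (2 / 3 * k) * m%:~R ^+ 2).
have g0 m : 0 <= g m by exact: expR_ge0.
have fg : zfin g by apply: zfin_gauss; rewrite mulr_gt0// divr_gt0.
have CG0 : 0 <= C * zsum g by rewrite mulr_ge0// zsum_ge0.
have bd0 lam : `|lam| <= 3 -> partition_fun k lam <= C * zsum g.
  move=> l3; rewrite -zsumZl//; apply: zsum_le => //.
  - by move=> m; exact: (hC m%:~R lam lam _ _).1.
  - exact: zfinZl.
have bd lam : partition_fun k lam <= C * zsum g.
  rewrite -[lam](subrK (Num.floor lam)%:~R) partition_fun_periodic; apply: bd0.
  have := floor_le_tmp lam; have := floorD1_gt lam; rewrite intrD ler_norml; lra.
exists (C * zsum g) => //; split => // lam lam'.
have [l1|l1] := leP 1 `|lam - lam'|.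
  apply: (@le_trans _ _ (C * zsum g)); last by rewrite ler_peMr.
  have := bd lam; have := bd lam'.
  have := partition_fun_gt0 lam k0; have := partition_fun_gt0 lam' k0.
  rewrite ler_norml; lra.
wlog [l3 l'3] : lam lam' l1 / `|lam| <= 3 /\ `|lam'| <= 3.
  move=> h; set c := Num.floor lam.
  rewrite -[lam](subrK c%:~R) -[lam'](subrK c%:~R) !partition_fun_periodic.
  have -> : lam - c%:~R + c%:~R - (lam' - c%:~R + c%:~R) = (lam - c%:~R) - (lam' - c%:~R) by ring.
  apply: h; first by rewrite (_ : _ - _ = lam - lam')//; ring.
  have := floor_le_tmp lam; have := floorD1_gt lam; rewrite -/c intrD.
  move: l1; rewrite ltr_norml !ler_norml; lra.
rewrite mulrAC -zsumZl//; last by rewrite mulr_ge0.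
apply: zsum_dist.
- by move=> m; exact: expR_ge0.
- by move=> m; exact: expR_ge0.
- by move=> m; exact: (hC m%:~R lam lam' _ _).2.
- exact: zfin_gauss_at.
- exact: zfin_gauss_at.
- by apply: zfinZl => //; rewrite mulr_ge0.
Qed.

Lemma dist_mul_le (a a' b b' A B La Lb D : R) :
  `|a'| <= A -> `|b| <= B -> `|a - a'| <= La * D -> `|b - b'| <= Lb * D ->
  `|a * b - a' * b'| <= (La * B + A * Lb) * D.
Proof.
move=> aA bB aD bD.
have -> : a * b - a' * b' = (a - a') * b + a' * (b - b') by ring.
apply: le_trans (ler_normD _ _) _; rewrite !normrM.
rewrite [leRHS](_ : _ = La * D * B + A * (Lb * D)); last by ring.
by apply: lerD; apply: ler_pM.
Qed.

Lemma dist_inv_le (a a' l L D : R) : 0 < l -> l <= a -> l <= a' ->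
  `|a - a'| <= L * D -> `|a^-1 - a'^-1| <= L / l ^+ 2 * D.
Proof.
move=> l0 la la' aD; have a0 := lt_le_trans l0 la; have a'0 := lt_le_trans l0 la'.
have -> : a^-1 - a'^-1 = (a' - a) / (a * a') by field; rewrite !gt_eqF.
rewrite normrM normfV (gtr0_norm (mulr_gt0 a0 a'0)) distrC mulrAC.
apply: ler_pM => //; first by rewrite invr_ge0 mulr_ge0// ltW.
by rewrite lef_pV2 ?posrE ?mulr_gt0 ?exprn_gt0// expr2 ler_pM// ltW.
Qed.

End PartitionFun.

(** * Regularity of the laws mu *)

Local Notation weight K n := (expR (- K * n%:~R ^+ 2 / 3)).

Section MuReg.
Context {R : realType}.
Implicit Types (K omega lam : R) (n : int).

Lemma mu_ge0 K omega lam n : 0 <= mu K omega lam n.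
Proof.
apply: fine_ge0; apply: esum_ge0 => m _; rewrite lee_fin.
by rewrite mulr_ge0// divr_ge0 ?expR_ge0//; apply: zsum_ge0 => ?; exact: expR_ge0.
Qed.

Lemma mu_periodic K omega lam n (c : int) :
  mu K omega (lam + c%:~R) n = mu K omega lam n.
Proof.
rewrite !muE /Q !partition_fun_periodic.
have -> : lam + c%:~R - omega = (lam - omega) + c%:~R by ring.
have -> : lam + c%:~R - 2^-1 * (omega + n%:~R) = (lam - 2^-1 * (omega + n%:~R)) + c%:~R by ring.
by rewrite !partition_fun_periodic.
Qed.

(** The Gaussian factor of the explicit form [muE] provides the decay in n, and the
loss from K/2 to K/3 in the exponent makes its constants uniform for bounded
omega. The factor Q is bounded and Lipschitz in (omega, lam) uniformly in n,
because n only enters as a translation of the argument of a periodic function. *)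
Lemma mu_reg K (M : R) : 0 < K -> 0 <= M -> exists2 C, 0 <= C &
  (forall omega lam n, `|omega| <= M ->
     mu K omega lam n <= C * weight K n) /\
  (forall omega omega' lam lam' n, `|omega| <= M -> `|omega'| <= M ->
     `|mu K omega lam n - mu K omega' lam' n| <=
       C * (`|omega - omega'| + `|lam - lam'|) * weight K n).
Proof.
move=> K0 M0.
have K2 : 0 < 2 * K by rewrite mulr_gt0.
have [A A0 [Abd Alip]] := partition_fun_reg K2.
have [B B0 [_ Blip]] := partition_fun_reg K0.
have [G G0 hG] := gauss_recenter (divr_gt0 K0 (ltr0n _ 2)) M0.
set l := expR (- K).
have l0 : 0 < l by exact: expR_gt0.
have lZ lam : l <= partition_fun K lam by exact: partition_fun_ge.
have iZ lam : `|(partition_fun K lam)^-1| <= l^-1.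
  rewrite normfV gtr0_norm ?partition_fun_gt0// lef_pV2 ?posrE ?partition_fun_gt0//.
have nA lam : `|partition_fun (2 * K) lam| <= A.
  by rewrite gtr0_norm ?partition_fun_gt0.
set Bq := A * (l^-1 * l^-1).
have nQ omega lam n : `|Q K n omega lam| <= Bq.
  by rewrite /Q invfM !normrM; apply: ler_pM => //; exact: ler_pM.
set Li := B / l ^+ 2; set Lq := A * (l^-1 * l^-1) + A * (Li * l^-1 + l^-1 * Li).
have lQ omega omega' lam lam' n :
    `|Q K n omega lam - Q K n omega' lam'| <= Lq * (`|omega - omega'| + `|lam - lam'|).
  have t0 := normr_ge0 (omega - omega'); have t1 := normr_ge0 (lam - lam').
  rewrite /Q !invfM; apply: dist_mul_le => //.
  - by rewrite normrM; apply: ler_pM.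
  - apply: le_trans (Alip _ _) _; rewrite ler_wpM2l//.
    rewrite (_ : _ - _ = (lam - lam') - 2^-1 * (omega - omega')); last by ring.
    apply: le_trans (ler_normB _ _) _; rewrite normrM gtr0_norm ?invr_gt0//; lra.
  - apply: dist_mul_le => //; apply: dist_inv_le => //; apply: le_trans (Blip _ _) _; rewrite ler_wpM2l//.
      rewrite (_ : _ - _ = (lam - lam') - (omega - omega')); last by ring.
      by apply: le_trans (ler_normB _ _) _; lra.
    by lra.
have Bq0 : 0 <= Bq by rewrite !mulr_ge0 ?invr_ge0// ltW.
have Li0 : 0 <= Li by rewrite divr_ge0// exprn_ge0// ltW.
have il0 : 0 <= l^-1 by rewrite invr_ge0 ltW.
have Lq0 : 0 <= Lq by apply: addr_ge0; apply: mulr_ge0 => //; [exact: mulr_ge0|apply: addr_ge0; exact: mulr_ge0].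
have expE (n : int) : - (2 / 3 * (K / 2)) * n%:~R ^+ 2 = - K * n%:~R ^+ 2 / 3 :> R by field.
exists (G * Bq + (G * Bq + G * Lq)); first by rewrite !addr_ge0// mulr_ge0.
split=> [omega lam n oM|omega omega' lam lam' n oM o'M].
  rewrite muE; have := (hG n%:~R omega omega oM oM).1; rewrite expE.
  set E := expR (- K * _ / 3) => h.
  apply: (@le_trans _ _ (G * E * Bq)).
    apply: le_trans (ler_norm _) _; rewrite normrM; apply: ler_pM => //.
    by rewrite ger0_norm ?expR_ge0.
  rewrite mulrAC ler_wpM2r ?expR_ge0// lerDl addr_ge0// mulr_ge0//.
rewrite !muE; have := (hG n%:~R omega' omega o'M oM).1.
have := (hG n%:~R omega omega' oM o'M).2; rewrite expE.
set E := expR (- K * _ / 3) => h1 h2.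
have E0 : 0 <= E by exact: expR_ge0.
have t0 := normr_ge0 (omega - omega'); have t1 := normr_ge0 (lam - lam').
apply: (@le_trans _ _ ((G * E * Bq + G * E * Lq) * (`|omega - omega'| + `|lam - lam'|))).
  apply: dist_mul_le => //.
  - by rewrite ger0_norm ?expR_ge0.
  - apply: le_trans h1 _; rewrite mulrAC ler_wpM2l ?mulr_ge0//; lra.
rewrite [leLHS](_ : _ = (G * Bq + G * Lq) * (`|omega - omega'| + `|lam - lam'|) * E); last by ring.
rewrite ler_wpM2r// ler_wpM2r ?addr_ge0// lerDr mulr_ge0//.
Qed.

End MuReg.

(** * The means of the laws mu *)

Section Mean.
Context {R : realType}.
Implicit Types (K omega lam : R) (a b p r : int -> R).

Definition pospart (x : R) : R := Num.max x 0.

Lemma pospart_ge0 x : 0 <= pospart x. Proof. by rewrite le_max lexx orbT. Qed.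

Lemma pospartBN x : pospart x - pospart (- x) = x.
Proof.
rewrite /pospart; have [x0|x0] := leP 0 x.
  by rewrite max_r ?oppr_le0// subr0.
by rewrite max_l ?oppr_ge0 ?(ltW x0)// sub0r opprK.
Qed.

Lemma pospart_le_norm x : pospart x <= `|x|.
Proof. by rewrite ge_max ler_norm normr_ge0. Qed.

Lemma esum_int_exchange (a : int -> int -> \bar R) :
  (forall m n, 0 <= a m n)%E ->
  (\esum_(m in [set: int]) \esum_(n in [set: int]) a m n =
   \esum_(n in [set: int]) \esum_(m in [set: int]) a m n)%E.
Proof.
move=> a0; rewrite !esum_esum//.
rewrite (reindex_esum ([set: int] `*`` (fun=> [set: int])) _ (fun x => (x.2, x.1)))//; split=> //=.
  by move=> [i j] [k l] /= _ _ [] -> ->.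
by move=> [i j] _; exists (j, i).
Qed.

(** The law of Z - Z' for independent Z' of law p and Z of law r; the definition of
[mu] is the instance where p and r are discrete Gaussians. *)
Definition diff_law p r (n : int) : R := zsum (fun m => p m * r (m + n)).

Section DiffLaw.
Variables p r : int -> R.
Hypotheses (p0 : forall m, 0 <= p m) (r0 : forall m, 0 <= r m).
Hypotheses (fp : zfin p) (fr : zfin r).

Lemma zfin_diff_law_term n : zfin (fun m => p m * r (m + n)).
Proof.
apply: (@zfin_le _ _ (fun m => zsum r * p m)).
  by move=> m; rewrite mulrC ler_wpM2r//; exact: zsum_ge_term.
by apply: zfinZl => //; exact: zsum_ge0.
Qed.

Lemma diff_law_ge0 n : 0 <= diff_law p r n.
Proof. by apply: zsum_ge0 => m; rewrite mulr_ge0. Qed.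

Lemma esum_diff_law :
  (\esum_(n in [set: int]) (diff_law p r n)%:E = (zsum p * zsum r)%:E)%E.
Proof.
transitivity (\esum_(n in [set: int]) \esum_(m in [set: int]) (p m * r (m + n))%:E)%E.
  apply: eq_esum => n _; rewrite zsumE//; first by move=> m; rewrite mulr_ge0.
  exact: zfin_diff_law_term.
rewrite esum_int_exchange; last by move=> *; rewrite lee_fin mulr_ge0.
transitivity (\esum_(m in [set: int]) (zsum r * p m)%:E)%E.
  apply: eq_esum => m _.
  rewrite (@esum_int_reindex _ (fun n => m + n) (fun n => - m + n) (fun n => (p m * r n)%:E)).
  - by rewrite esumZl_zsum// mulrC.
  - by move=> n; rewrite addKr.
  - by move=> n; rewrite addNKr.
by rewrite esumZl_zsum ?zsum_ge0// mulrC.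
Qed.

Lemma zfin_diff_law : zfin (diff_law p r).
Proof. by rewrite /zfin esum_diff_law ltry. Qed.

Lemma zsum_diff_law : zsum (diff_law p r) = zsum p * zsum r.
Proof. by rewrite {1}/zsum esum_diff_law. Qed.

End DiffLaw.

Lemma norm_gauss_le (k y : R) : 0 < k ->
  `|y| * expR (- k * y ^+ 2) <= (1 + 2 / k) * expR (- (k / 2) * y ^+ 2).
Proof.
move=> k0; have -> : - k * y ^+ 2 = - (k / 2) * y ^+ 2 - (k / 2) * y ^+ 2 by field.
rewrite expRD mulrCA [leRHS]mulrC ler_pM2l ?expR_gt0// expRN ler_pdivrMr ?expR_gt0//.
have h := expR_ge1Dx (k / 2 * y ^+ 2).
have k2 : 2 / k * (k / 2 * y ^+ 2) = `|y| ^+ 2 by rewrite real_normK ?num_real//; field; rewrite gt_eqF.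
have i0 : 0 < 2 / k by rewrite divr_gt0.
have X0 : 0 <= k / 2 * y ^+ 2 by rewrite mulr_ge0 ?sqr_ge0 ?divr_ge0// ltW.
set X := k / 2 * y ^+ 2 in h k2 X0 *; set E := expR X in h *.
have := sqr_ge0 (`|y| - 1); nra.
Qed.

Lemma zfin_norm_gauss (k lam : R) : 0 < k ->
  zfin (fun m => `|m%:~R - lam| * expR (- k * (m%:~R - lam) ^+ 2)).
Proof.
move=> k0; apply: zfin_le (fun m => norm_gauss_le (m%:~R - lam) k0) _.
apply: zfinZl; first by rewrite addr_ge0// divr_ge0// ltW.
  by move=> m; exact: expR_ge0.
by apply: zfin_gauss_at; rewrite divr_gt0.
Qed.

Lemma rho_ge0 K lam m : 0 < K -> 0 <= rho K lam m.
Proof. by move=> K0; rewrite divr_ge0 ?expR_ge0// ltW// partition_fun_gt0. Qed.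

Lemma zfin_rho K lam : 0 < K -> zfin (rho K lam).
Proof.
move=> K0; rewrite /rho; under eq_fun do rewrite mulrC.
apply: zfinZl; first by rewrite invr_ge0 ltW// partition_fun_gt0.
  by move=> m; exact: expR_ge0.
exact: zfin_gauss_at.
Qed.

Lemma zsum_rho K lam : 0 < K -> zsum (rho K lam) = 1.
Proof.
move=> K0; rewrite /rho; under eq_fun do rewrite mulrC.
rewrite zsumZl; last by move=> m; exact: expR_ge0.
  by rewrite mulVf// gt_eqF// partition_fun_gt0.
by rewrite invr_ge0 ltW// partition_fun_gt0.
Qed.

(** The mean of rho K lam minus lam; the two parts of the sum are kept apart because
infinite sums are only formed of non-negative terms. *)
Definition bias K lam : R :=
  zsum (fun m => rho K lam m * pospart (m%:~R - lam)) -
  zsum (fun m => rho K lam m * pospart (- (m%:~R - lam))).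

Lemma zfin_rho_dev K lam (u : int -> R) : 0 < K ->
  (forall m, 0 <= u m <= `|m%:~R - lam|) -> zfin (fun m => rho K lam m * u m).
Proof.
move=> K0 hu.
apply: (@zfin_le _ _ (fun m => (partition_fun K lam)^-1 *
          (`|m%:~R - lam| * expR (- K * (m%:~R - lam) ^+ 2)))).
  move=> m; rewrite /rho mulrAC mulrC ler_wpM2l ?invr_ge0 ?(ltW (partition_fun_gt0 _ _))//.
  by rewrite mulrC ler_wpM2r ?expR_ge0//; case/andP: (hu m).
apply: zfinZl; first by rewrite invr_ge0 (ltW (partition_fun_gt0 _ _)).
  by move=> m; rewrite mulr_ge0 ?expR_ge0.
exact: zfin_norm_gauss.
Qed.

(** The deviation |m - lam| is absorbed by half of the exponent, which leaves the
ratio of the partition functions of parameters K/2 and K. *)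
Lemma bias_bounded K : 0 < K -> exists2 B, 0 <= B & forall lam, `|bias K lam| <= B.
Proof.
move=> K0; have K2 : 0 < K / 2 by rewrite divr_gt0.
have [A A0 [Abd _]] := partition_fun_reg K2.
have Z0 lam : 0 < partition_fun K lam by exact: partition_fun_gt0.
set B := expR K * ((1 + 2 / K) * A).
have c0 : 0 <= 1 + 2 / K by rewrite addr_ge0// divr_ge0// ltW.
have bd lam (u : int -> R) : (forall m, 0 <= u m <= `|m%:~R - lam|) ->
    zsum (fun m => rho K lam m * u m) <= B.
  move=> hu.
  apply: (@le_trans _ _ (zsum (fun m => (partition_fun K lam)^-1 *
          ((1 + 2 / K) * expR (- (K / 2) * (m%:~R - lam) ^+ 2))))).
    apply: zsum_le.
    - by move=> m; rewrite mulr_ge0 ?rho_ge0//; case/andP: (hu m).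
    - move=> m; rewrite /rho mulrAC mulrC ler_wpM2l ?invr_ge0 ?(ltW (Z0 _))//.
      apply: le_trans (norm_gauss_le _ K0); rewrite mulrC ler_wpM2r ?expR_ge0//.
      by case/andP: (hu m).
    - apply: zfinZl; first by rewrite invr_ge0 ltW.
        by move=> m; rewrite mulr_ge0 ?expR_ge0.
      apply: zfinZl => //; exact: zfin_gauss_at.
  rewrite zsumZl ?invr_ge0 ?(ltW (Z0 _))//; last by move=> m; rewrite mulr_ge0 ?expR_ge0.
  rewrite zsumZl//; apply: ler_pM.
  - by rewrite invr_ge0 ltW.
  - by rewrite mulr_ge0// zsum_ge0.
  - rewrite -[expR K]invrK -expRN lef_pV2 ?posrE ?expR_gt0//.
    exact: partition_fun_ge.
  - by rewrite ler_wpM2l// Abd.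
exists B; first by rewrite !mulr_ge0 ?expR_ge0.
move=> lam.
have h1 : zsum (fun m => rho K lam m * pospart (m%:~R - lam)) <= B.
  by apply: bd => m; rewrite pospart_ge0 pospart_le_norm.
have h2 : zsum (fun m => rho K lam m * pospart (- (m%:~R - lam))) <= B.
  by apply: bd => m; rewrite pospart_ge0 -[leRHS]normrN pospart_le_norm.
have p1 : 0 <= zsum (fun m => rho K lam m * pospart (m%:~R - lam)).
  by apply: zsum_ge0 => m; rewrite mulr_ge0 ?rho_ge0// pospart_ge0.
have p2 : 0 <= zsum (fun m => rho K lam m * pospart (- (m%:~R - lam))).
  by apply: zsum_ge0 => m; rewrite mulr_ge0 ?rho_ge0// pospart_ge0.
rewrite /bias ler_norml; lra.
Qed.

Lemma zfin_mu_norm K omega lam : 0 < K ->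
  zfin (fun n => mu K omega lam n * `|n%:~R - omega|).
Proof.
move=> K0; have [C C0 [hC _]] := mu_reg K0 (normr_ge0 omega).
have K3 : 0 < K / 3 by rewrite divr_gt0.
apply: (@zfin_le _ _ (fun n => C * (`|n%:~R - 0| * expR (- (K / 3) * (n%:~R - 0) ^+ 2)) +
   C * `|omega| * expR (- (K / 3) * (n%:~R - 0) ^+ 2))).
  move=> n; rewrite subr0; set G := expR _.
  rewrite [leRHS](_ : _ = C * G * (`|n%:~R| + `|omega|)); last by ring.
  apply: ler_pM => //; first exact: mu_ge0.
    by rewrite /G (_ : - (K / 3) * _ = - K * n%:~R ^+ 2 / 3) ?hC//; field.
  exact: ler_normB.
apply: zfinD.
- by move=> n; rewrite !mulr_ge0 ?expR_ge0.
- by move=> n; rewrite !mulr_ge0 ?expR_ge0.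
- apply: zfinZl; rewrite //; last exact: zfin_norm_gauss.
- by apply: zfinZl; rewrite ?mulr_ge0//; exact: zfin_gauss_at.
Qed.

(** A variable of law mu is a difference Z - Z' of independent variables of laws
rho K lam and rho K (lam - omega), so its mean exceeds omega by the difference of
their biases. The proof writes n - omega as u - v, where u and v are the
deviations of Z and Z', and moves negative parts to the other side of the
equation. *)
Lemma mu_bias K omega lam : 0 < K ->
  zsum (fun n => mu K omega lam n * pospart (n%:~R - omega)) -
  zsum (fun n => mu K omega lam n * pospart (- (n%:~R - omega))) =
  bias K lam - bias K (lam - omega).
Proof.
move=> K0.
set p := rho K (lam - omega); set q := rho K lam.
pose u (k : int) := k%:~R - lam; pose v (k : int) := k%:~R - (lam - omega).
have p0 m : 0 <= p m by exact: rho_ge0.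
have q0 m : 0 <= q m by exact: rho_ge0.
have fp : zfin p by exact: zfin_rho.
have fq : zfin q by exact: zfin_rho.
pose qu s k := q k * pospart (s * u k); pose pv s k := p k * pospart (s * v k).
have qu0 s k : 0 <= qu s k by rewrite mulr_ge0// pospart_ge0.
have pv0 s k : 0 <= pv s k by rewrite mulr_ge0// pospart_ge0.
have fqu s : `|s| = 1 -> zfin (qu s).
  move=> s1; apply: zfin_rho_dev => // m.
  by rewrite pospart_ge0/= (le_trans (pospart_le_norm _))// normrM s1 mul1r.
have fpv s : `|s| = 1 -> zfin (pv s).
  move=> s1; apply: zfin_rho_dev => // m.
  by rewrite pospart_ge0/= (le_trans (pospart_le_norm _))// normrM s1 mul1r.
have n1 : `|1 : R| = 1 by rewrite normr1.
have nN1 : `|-1 : R| = 1 by rewrite normrN1.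
have fmu s : `|s| = 1 -> zfin (fun n => pospart (s * (n%:~R - omega)) * mu K omega lam n).
  move=> s1; apply: zfin_le (zfin_mu_norm omega lam K0) => n.
  rewrite mulrC ler_wpM2l ?mu_ge0// (le_trans (pospart_le_norm _))// normrM s1 mul1r//.
have mu0 s n : 0 <= pospart (s * (n%:~R - omega)) * mu K omega lam n.
  by rewrite mulr_ge0 ?pospart_ge0 ?mu_ge0.
(* for s = 1 and s = -1 these are the two sides of the equation, at a given n *)
have side s n : `|s| = 1 ->
    pospart (s * (n%:~R - omega)) * mu K omega lam n + diff_law p (qu (- s)) n + diff_law (pv s) q n =
    zsum (fun m => p m * q (m + n) * (pospart (s * (n%:~R - omega)) + pospart (- s * u (m + n)) + pospart (s * v m))).
  move=> s1; have Ns1 : `|- s| = 1 by rewrite normrN.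
  have f1 := zfin_diff_law_term p0 q0 fp fq n.
  have f2 := zfin_diff_law_term p0 (qu0 (- s)) fp (fqu _ Ns1) n.
  have f3 := zfin_diff_law_term (pv0 s) q0 (fpv _ s1) fq n.
  have t1 m : 0 <= p m * q (m + n) by rewrite mulr_ge0.
  have t2 m : 0 <= p m * qu (- s) (m + n) by rewrite mulr_ge0.
  have t3 m : 0 <= pv s m * q (m + n) by rewrite mulr_ge0.
  have g1 : zfin (fun m => pospart (s * (n%:~R - omega)) * (p m * q (m + n))).
    by apply: zfinZl => //; exact: pospart_ge0.
  rewrite -[mu K omega lam n]/(diff_law p q n) /diff_law -zsumZl ?pospart_ge0// -zsumD//; last first.
    by move=> m; rewrite mulr_ge0 ?pospart_ge0.
  rewrite -zsumD//.
  - by congr zsum; apply/funext => m; rewrite /qu /pv; ring.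
  - by move=> m; rewrite addr_ge0// mulr_ge0 ?pospart_ge0.
  - by apply: zfinD => // m; rewrite mulr_ge0 ?pospart_ge0.
have eqs n : pospart (1 * (n%:~R - omega)) * mu K omega lam n + diff_law p (qu (- 1)) n + diff_law (pv 1) q n =
    pospart (- 1 * (n%:~R - omega)) * mu K omega lam n + diff_law p (qu (- -1)) n + diff_law (pv (- 1)) q n.
  rewrite !side//; congr zsum; apply/funext => m; congr (_ * _).
  have e1 := pospartBN (n%:~R - omega); have e2 := pospartBN (u (m + n)); have e3 := pospartBN (v m).
  rewrite opprK !mul1r !mulN1r.
  have e4 : u (m + n) - v m = n%:~R - omega by rewrite /u /v intrD; ring.
  lra.
have tot s : `|s| = 1 -> zsum (fun n => pospart (s * (n%:~R - omega)) * mu K omega lam n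
       + diff_law p (qu (- s)) n + diff_law (pv s) q n) =
     zsum (fun n => pospart (s * (n%:~R - omega)) * mu K omega lam n) + zsum (qu (- s)) + zsum (pv s).
  move=> s1; have Ns1 : `|- s| = 1 by rewrite normrN.
  have c2 := zfin_diff_law p0 (qu0 (- s)) fp (fqu _ Ns1).
  have c3 := zfin_diff_law (pv0 s) q0 (fpv _ s1) fq.
  have d2 := diff_law_ge0 p0 (qu0 (- s)).
  have d3 := diff_law_ge0 (pv0 s) q0.
  have f0 := fmu _ s1.
  rewrite zsumD//.
  - rewrite zsumD// zsum_diff_law//; last exact: fqu.
    rewrite zsum_diff_law//; last exact: fpv.
    by rewrite !zsum_rho// mul1r mulr1.
  - by move=> m; rewrite addr_ge0.
  - exact: zfinD.
have := congr1 zsum (funext eqs); rewrite !tot// opprK.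
have E s : zsum (fun n => pospart (s * (n%:~R - omega)) * mu K omega lam n) =
   zsum (fun n => mu K omega lam n * pospart (s * (n%:~R - omega))).
  by congr zsum; apply/funext => n; rewrite mulrC.
rewrite !E /bias -/p -/q /qu /pv /u /v.
have F (a : int -> R) (b : int -> R) : zsum (fun n => a n * pospart (1 * b n)) = zsum (fun n => a n * pospart (b n)).
  by congr zsum; apply/funext => n; rewrite mul1r.
have G (a : int -> R) (b : int -> R) : zsum (fun n => a n * pospart (-1 * b n)) = zsum (fun n => a n * pospart (- b n)).
  by congr zsum; apply/funext => n; rewrite mulN1r.
rewrite !F !G; lra.
Qed.

End Mean.

(** * Expectations of integer-valued variables *)

Section IntLaw.
Context d (T : measurableType d) (R : realType) (P : probability T R).
Variables (X : T -> int) (p : int -> R).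
Hypothesis mX : forall n, measurable (X @^-1` [set n]).
Hypothesis lawX : forall n, P (X @^-1` [set n]) = (p n)%:E.

Lemma measurable_fun_int d' (U : measurableType d') (f : int -> U) :
  measurable_fun [set: T] (fun om => f (X om)).
Proof.
move=> _ Y mY; rewrite setTI.
rewrite (_ : _ @^-1` _ = \bigcup_n (if f n \in Y then X @^-1` [set n] else set0)).
  apply: countable_bigcupT_measurable; first exact: countableP.
  by move=> n; case: ifPn.
apply/seteqP; split => [om Yf|om [n _]] /=.
  by exists (X om) => //; rewrite mem_set.
by case: ifPn => //= /set_mem Yn ->.
Qed.

Lemma law_ge0 n : 0 <= p n.
Proof. by rewrite -lee_fin -lawX. Qed.

(** The integral is split along the countable partition by the values of X, which
are numbered by [pickle]; the codes that are not reached contribute empty sets. *)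
Lemma integral_int_law (f : int -> R) : (forall n, 0 <= f n) ->
  (\int[P]_om (f (X om))%:E = \esum_(n in [set: int]) (f n * p n)%:E)%E.
Proof.
move=> f0.
pose F k := [set om | pickle (X om) = k].
have mF k : measurable (F k).
  rewrite -[F k]setTI.
  by apply: (measurable_fun_int (U := nat) (fun n => pickle n) measurableT (Y := [set k])).
have UF : [set: T] = \bigcup_k F k.
  by apply/seteqP; split => // om _; exists (pickle (X om)).
rewrite [in LHS]UF ge0_integral_bigcup//=; first last.
- by move=> i j _ _ [om [/= <- <-]].
- by move=> om _; rewrite lee_fin.
- rewrite -UF; apply/measurable_EFinP; exact: measurable_fun_int.
have Fn n : F (pickle n) = X @^-1` [set n].
  apply/seteqP; split => om /=; last by move=> <-.
  by move=> /(pcan_inj pickleK).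
rewrite nneseries_esumT; last by move=> k; apply: integral_ge0 => om _; rewrite lee_fin.
rewrite (esumID (range (@pickle int)))/=; last first.
  by move=> k _; apply: integral_ge0 => om _; rewrite lee_fin.
rewrite [X in (_ + X)%E]esum1 ?adde0; last first.
  move=> k [_ kN]; rewrite (_ : F k = set0) ?integral_set0//.
  by apply/seteqP; split => // om /= h; apply: kN; exists (X om).
rewrite setTI esum_image; last by move=> m n _ _; exact: pcan_inj pickleK _ _.
apply: eq_esum => n _.
rewrite Fn (eq_integral (cst (f n)%:E)); last first.
  by move=> om /set_mem /= <-.
by rewrite integral_cst// EFinM; congr (_ * _)%E; exact: lawX.
Qed.

Lemma integrable_int (f : int -> R) : zfin (fun n => `|f n| * p n) ->
  P.-integrable [set: T] (EFin \o (fun om => f (X om))).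
Proof.
move=> ff; apply/integrableP; split.
  exact: (@measurable_fun_int _ _ (fun n => (f n)%:E)).
by rewrite (integral_int_law (fun n => normr_ge0 (f n))).
Qed.

Lemma expectation_int (f : int -> R) : zfin (fun n => `|f n| * p n) ->
  ('E_P[fun om => f (X om)] =
   (zsum (fun n => pospart (f n) * p n) - zsum (fun n => pospart (- f n) * p n))%:E)%E.
Proof.
move=> ff; rewrite unlock integralE EFinB.
have fin (g : int -> R) : (forall n, 0 <= g n <= `|f n|) -> zfin (fun n => g n * p n).
  by move=> gf; apply: zfin_le ff => n; rewrite ler_wpM2r ?law_ge0//; case/andP: (gf n).
congr (_ - _)%E.
- rewrite -zsumE.
  + rewrite -integral_int_law; last by move=> n; exact: pospart_ge0.
    by apply: eq_integral => om _; rewrite funeposE EFin_max.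
  + by move=> n; rewrite mulr_ge0 ?pospart_ge0 ?law_ge0.
  + by apply: fin => n; rewrite pospart_ge0 pospart_le_norm.
- rewrite -zsumE.
  + rewrite -integral_int_law; last by move=> n; exact: pospart_ge0.
    by apply: eq_integral => om _; rewrite funenegE EFin_max EFinN.
  + by move=> n; rewrite mulr_ge0 ?pospart_ge0 ?law_ge0.
  + by apply: fin => n; rewrite pospart_ge0 -[leRHS]normrN pospart_le_norm.
Qed.

End IntLaw.

(** * The sites of a block *)

Section Sites.
Context {R : realType}.

Lemma sites_interval (N : nat) (x e : R) : (0 < N)%N -> 0 < e ->
  exists a (S : nat), [/\ `|S%:R - 2 * N%:R * e| <= 1,
    sites N x e = [set` [seq a + k%:Z | k <- iota 0 S]] &
    forall u : int -> R, \sum_(i \in sites N x e) u i = \sum_(k < S) u (a + k%:Z)].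
Proof.
move=> N0 e0; set A := N%:R * x - N%:R * e; set B := N%:R * x + N%:R * e.
have Ne : 0 < N%:R * e by rewrite mulr_gt0 ?ltr0n.
have a1 := floor_le_tmp A; have a2 := floorD1_gt A.
have b1 := ceil_ge B; have b2 := ceilB1_lt B.
set fa := Num.floor A in a1 a2 *; set cb := Num.ceil B in b1 b2 *.
rewrite intrD rmorph1 in a2; rewrite intrB in b2.
have lt_fc : (fa < cb)%R.
  by rewrite -(ltr_int R); move: Ne a1 b1; rewrite /A /B; lra.
pose S := absz (cb - fa - 1)%R.
have SE : S%:Z = cb - fa - 1.
  by rewrite /S gez0_abs// subr_ge0 lerBrDl lezD1 -subr_gt0 subr_gt0.
have sE : sites N x e = [set` [seq (fa + 1) + k%:Z | k <- iota 0 S]].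
  have inE' (i : int) : sites N x e i <-> (fa < i < cb)%R.
    rewrite /sites /= ltr_norml; split.
      move=> /andP[h1 h2]; rewrite -!(ltr_int R); move: h1 h2 a1 b1; rewrite /A /B; lra.
    move=> /andP[]; rewrite -lezD1 -[i < cb]lezD1 -!(ler_int R) !intrD.
    move: a2 b2; rewrite /A /B => *; apply/andP; split; lra.
  apply/seteqP; split => i /=.
    move=> /inE' /andP[ia ib]; apply/mapP.
    exists (absz (i - fa - 1)%R); last by rewrite gez0_abs; lia.
    by rewrite mem_iota /= add0n -ltz_nat SE gez0_abs; lia.
  move=> /mapP[k]; rewrite mem_iota add0n => /andP[_ kS] ->.
  by apply/inE'; move: kS; rewrite -ltz_nat SE; lia.
exists (fa + 1), S; split => //.
- have -> : S%:R = cb%:~R - fa%:~R - 1 :> R by rewrite pmulrn SE !intrB.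
  by move: a1 a2 b1 b2; rewrite /A /B ler_norml => *; lra.
- move=> u; rewrite sE -fsbig_seq; last first.
    by rewrite map_inj_uniq ?iota_uniq// => i j /addrI [].
  by rewrite big_map -[S in iota 0 S]subn0 -/(index_iota 0 S) big_mkord.
Qed.
End Sites.

(** * Rational approximation *)

Section Approx.
Context {R : realType}.

(** Pigeonhole principle: the M + 1 fractional parts of k W, for k <= M, fall into M
intervals of length 1/M. *)
Lemma dirichlet (W : R) (M : nat) : (0 < M)%N ->
  exists q (p : int), (0 < q)%N /\ `|q%:R * W - p%:~R| < M%:R^-1.
Proof.
move=> M0; have M0' : 0 < M%:R :> R by rewrite ltr0n.
pose f (k : nat) : R := k%:R * W - (Num.floor (k%:R * W))%:~R.
have f0 k : 0 <= f k by rewrite subr_ge0 floor_le_tmp.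
have f1 k : f k < 1 by have := floorD1_gt (k%:R * W); rewrite intrD /f; lra.
pose b k := absz (Num.floor (M%:R * f k)).
have bE k : (b k)%:Z = Num.floor (M%:R * f k).
  by rewrite gez0_abs// floor_ge0 mulr_ge0.
have bM k : (b k < M)%N.
  rewrite -ltz_nat bE -(ltr_int R); apply: le_lt_trans (floor_le_tmp _) _.
  by rewrite -pmulrn gtr_pMr.
have /injectivePn[i [j ij bij]] : ~~ injectiveb (fun k : 'I_M.+1 => Ordinal (bM k)).
  by apply/injectiveP => /leq_card; rewrite !card_ord ltnn.
wlog lt_ij : i j ij bij / (i < j)%N.
  move=> h; have [|ji|e] := ltngtP i j; first exact: h.
  - by apply: (h j i) => //; rewrite eq_sym.
  - by case/eqP: ij; exact: val_inj.
exists (j - i)%N, (Num.floor (j%:R * W) - Num.floor (i%:R * W)).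
split; first by rewrite subn_gt0.
have -> : (j - i)%:R * W - (Num.floor (j%:R * W) - Num.floor (i%:R * W))%:~R = f j - f i.
  by rewrite natrB ?(ltnW lt_ij)// intrB /f; ring.
have e : b i = b j by case: bij.
have := floor_le_tmp (M%:R * f i); have := floorD1_gt (M%:R * f i).
have := floor_le_tmp (M%:R * f j); have := floorD1_gt (M%:R * f j).
rewrite -!bE e !intrD.
move: (f i) (f j) => x y u1 u2 u3 u4.
rewrite -[M%:R^-1]mul1r ltr_pdivlMr// -[X in _ * X < _](gtr0_norm M0') -normrM ltr_norml.
by apply/andP; split; lra.
Qed.

(** For each of the finitely many q the fractional part of q W lies strictly
between 0 and 1. *)
Lemma irrational_dist (W : R) (Q0 : nat) : irrational W ->
  exists2 c : R, 0 < c & forall (q : nat) (p : int), (0 < q < Q0)%N -> c <= `|q%:R * W - p%:~R|.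
Proof.
move=> Wirr; elim: Q0 => [|Q [c c0 hc]]; first by exists 1 => // q p; rewrite ltn0 andbF.
have [Q0|Q0] := posnP Q.
  by exists 1 => // q p; rewrite Q0; case: q.
set f := Q%:R * W - (Num.floor (Q%:R * W))%:~R.
have f0 : 0 < f.
  rewrite lt_neqAle subr_ge0 floor_le_tmp andbT; apply/eqP => fe.
  apply: Wirr; apply/rationalP; exists (Num.floor (Q%:R * W)), Q.
  apply: (canRL (mulfK _)); first by rewrite pnatr_eq0 -lt0n.
  by move: fe; rewrite /f; lra.
have f1 : 0 < 1 - f by have := floorD1_gt (Q%:R * W); rewrite intrD /f; lra.
exists (Num.min c (Num.min f (1 - f))); first by rewrite !lt_min c0 f0.
move=> q p /andP[q0]; rewrite ltnS leq_eqVlt => /predU1P[->|qQ]; last first.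
  by rewrite ge_min hc// q0.
rewrite !ge_min; apply/orP; right.
have [pf|pf] := leP p (Num.floor (Q%:R * W)).
  apply/orP; left; move: pf; rewrite -(ler_int R) => pf.
  by apply: le_trans (ler_norm _); rewrite /f; lra.
apply/orP; right; move: pf; rewrite -lezD1 -(ler_int R) intrD => pf.
by rewrite distrC; apply: le_trans (ler_norm _); rewrite /f; lra.
Qed.

(** Reducing a good approximation to lowest terms makes it better, and
irrationality then keeps its denominator large. *)
Lemma irrational_approx (W : R) (Q0 : nat) (eta : R) : irrational W -> 0 < eta ->
  exists q (p : int), [/\ (0 < q)%N, (Q0 <= q)%N, coprimez p q & `|q%:R * W - p%:~R| <= eta].
Proof.
move=> Wirr eta0; have [c c0 hc] := irrational_dist Q0 Wirr.
set m := Num.min c eta; have m0 : 0 < m by rewrite lt_min c0.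
have [M M1] : exists M : nat, M.+1%:R^-1 < m.
  exists (absz (Num.floor m^-1)).
  rewrite invf_plt ?posrE ?ltr0n// -natr1 pmulrn gez0_abs ?floor_ge0 ?invr_ge0 ?(ltW m0)//.
  by have := floorD1_gt m^-1; rewrite intrD.
have [q [p [q0 hqp]]] := dirichlet W (ltn0Sn M).
set g := gcdn `|p|%N q.
have g0 : (0 < g)%N by rewrite gcdn_gt0 q0 orbT.
have gq : (g %| q)%N by exact: dvdn_gcdr.
have gp : (g%:Z %| p)%Z by rewrite dvdzE; exact: dvdn_gcdl.
have qE : q = ((q %/ g) * g)%N by rewrite divnK.
have pE : p = (p %/ g)%Z * g%:Z by rewrite divzK.
have dist : `|(q %/ g)%:R * W - (p %/ g)%Z%:~R| < m.
  apply: le_lt_trans (lt_trans hqp M1).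
  rewrite {2}qE {2}pE natrM intrM -pmulrn.
  rewrite (_ : _ * g%:R * W - _ = g%:R * ((q %/ g)%:R * W - (p %/ g)%Z%:~R)); last by ring.
  by rewrite normrM normr_nat ler_peMl// ler1n.
exists (q %/ g)%N, (p %/ g)%Z; split.
- by rewrite divn_gt0// dvdn_leq.
- rewrite leqNgt; apply/negP => lt; have := hc (q %/ g)%N (p %/ g)%Z.
  rewrite lt divn_gt0// dvdn_leq// => /(_ isT); move: dist; rewrite lt_min => /andP[+ _].
  by move=> h1 /(lt_le_trans h1); rewrite ltxx.
- rewrite coprimezE /=; rewrite /coprime -(eqn_pmul2r g0) muln_gcdl mul1n.
  rewrite -{1}[X in (_ * X)%N]/(absz g) -abszM -pE -qE.
  by [].
- by move: dist; rewrite lt_min => /andP[_ /ltW].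
Qed.

End Approx.

(** * Equidistribution of a drifting sequence *)

Section Equidistribution.
Context {R : realType}.
Variables (F : R -> R) (L B : R).
Hypotheses (L0 : 0 <= L) (Flip : forall x y, `|F x - F y| <= L * `|x - y|).
Hypothesis Fper : forall x (c : int), F (x + c%:~R) = F x.
Hypothesis FB : forall x, `|F x| <= B.

Notation leb := (@lebesgue_measure R).
Let I := \int[leb]_(x in `[0, 1]) F x.

Lemma lip_continuous : continuous F.
Proof.
move=> x; apply/cvgrPdist_le => e e0.
have L1 : 0 < L + 1 by rewrite ltr_wpDl.
have : \forall y \near x, `|x - y| <= e / (L + 1).
  have d0 : 0 < e / (L + 1) by rewrite divr_gt0.
  exact: (@cvgr_dist_le R R R (nbhs x) _ id x (fun _ h => h) _ d0).
apply: filterS => y; rewrite ler_pdivlMr// => xy.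
apply: le_trans (Flip _ _) _; apply: le_trans xy.
by rewrite mulrC ler_wpM2l// lerDl.
Qed.

Lemma lip_integrable (a b : R) : leb.-integrable `[a, b] (EFin \o F).
Proof.
apply: continuous_compact_integrable; first exact: segment_compact.
exact/continuous_subspaceT/lip_continuous.
Qed.

Lemma lip_integrable_oc (a b : R) : leb.-integrable `]a, b] (EFin \o F).
Proof.
apply: integrableS (lip_integrable a b) => //.
by apply: subset_itvr; rewrite bnd_simp.
Qed.

Lemma Rintegral_lip_dist (a b s : R) : a <= s <= b ->
  `|\int[leb]_(x in `]a, b]) F x - (b - a) * F s| <= L * (b - a) ^+ 2.
Proof.
move=> /andP[as_ sb]; have ab := le_trans as_ sb.
have m : leb `]a, b] = (b - a)%:E.
  rewrite lebesgue_measure_itv/= lte_fin.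
  by move: ab; rewrite le_eqVlt => /predU1P[->|->]; rewrite ?ltxx ?subrr.
have int_cst (c : R) : \int[leb]_(x in `]a, b]) c = (b - a) * c.
  by rewrite Rintegral_cst// [X in fine X]m /= mulrC.
have icst (c : R) : leb.-integrable `]a, b] (EFin \o cst c).
  have h : leb.-integrable `[a, b] (EFin \o cst c).
    apply: continuous_compact_integrable; first exact: segment_compact.
    by apply: continuous_subspaceT => ?; exact: cvg_cst.
  by apply: integrableS h => //; apply: subset_itvr; rewrite bnd_simp.
have bd x : x \in `]a, b] -> `|F x - F s| <= L * (b - a).
  rewrite in_itv/= => /andP[ax xb]; apply: le_trans (Flip _ _) _.
  by rewrite ler_wpM2l// ler_norml; lra.
rewrite ler_norml; apply/andP; split.
  rewrite lerBrDl; apply: (@le_trans _ _ (\int[leb]_(x in `]a, b]) (F s - L * (b - a)))).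
    by rewrite int_cst le_eqVlt; apply/orP; left; apply/eqP; ring.
  apply: le_Rintegral => //; [exact: icst|exact: lip_integrable_oc|].
  by move=> x /= /bd; rewrite ler_norml; lra.
rewrite lerBlDl; apply: (@le_trans _ _ (\int[leb]_(x in `]a, b]) (F s + L * (b - a)))).
  apply: le_Rintegral => //; [exact: lip_integrable_oc|exact: icst|].
  by move=> x /= /bd; rewrite ler_norml; lra.
by rewrite int_cst le_eqVlt; apply/orP; left; apply/eqP; ring.
Qed.

(** Each of the q cells contributes an error L / q^2 to the integral. *)
Lemma riemann_sum_dist (q : nat) (s : nat -> R) : (0 < q)%N ->
  (forall j, (j < q)%N -> j%:R / q%:R <= s j <= j.+1%:R / q%:R) ->
  `|\sum_(j < q) F (s j) - q%:R * I| <= L.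
Proof.
move=> q0 hs; have q0' : 0 < q%:R :> R by rewrite ltr0n.
have key j : (j <= q)%N ->
    `|\int[leb]_(x in `[0, (j%:R / q%:R)]) F x - q%:R^-1 * \sum_(i < j) F (s i)|
    <= j%:R * (L * q%:R^-1 ^+ 2).
  elim: j => [_|j IH jq].
    by rewrite mul0r set_itv1 Rintegral_set1 big_ord0 mulr0 subr0 normr0 mul0r.
  have /andP[s1 s2] := hs _ jq.
  have := Rintegral_itvB (lip_integrable 0 (j.+1%:R / q%:R)) (x := j%:R / q%:R).
  rewrite !bnd_simp => /(_ _ _)/[dup] _.
  have j0 : 0 <= j%:R / q%:R :> R by rewrite divr_ge0.
  have jj : j%:R / q%:R <= j.+1%:R / q%:R :> R by exact: le_trans s2.
  move=> /(_ j0 jj) E.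
  have w : j.+1%:R / q%:R - j%:R / q%:R = q%:R^-1 :> R.
    by rewrite -mulrBl -natr1 addrAC subrr add0r mul1r.
  have := Rintegral_lip_dist (hs _ jq); rewrite -E w big_ord_recr /=.
  move=> h; have {}IH := IH (ltnW jq).
  rewrite [leRHS](_ : _ = L * q%:R^-1 ^+ 2 + j%:R * (L * q%:R^-1 ^+ 2)); last by rewrite -natr1; ring.
  rewrite [X in `|X|](_ : _ = (\int[leb]_(x in `[0%R, (j.+1%:R / q%:R)]) F x -
    \int[leb]_(x in `[0%R, (j%:R / q%:R)]) F x - q%:R^-1 * F (s j)) +
    (\int[leb]_(x in `[0%R, (j%:R / q%:R)]) F x - q%:R^-1 * \sum_(i < j) F (s i))); last by ring.
  by apply: le_trans (ler_normD _ _) _; exact: lerD.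
have := key q (leqnn q); rewrite divff ?gt_eqF// -/I => h.
rewrite distrC.
rewrite (_ : _ - _ = q%:R * (I - q%:R^-1 * \sum_(i < q) F (s i))); last first.
  by rewrite mulrBr mulrA divff ?gt_eqF// mul1r.
rewrite normrM (gtr0_norm q0') -ler_pdivlMl//.
rewrite (_ : _^-1 * L = q%:R * (L * q%:R^-1 ^+ 2))//.
by field; rewrite gt_eqF.
Qed.

(** When p is coprime to q, the multiples of p/q run through all the q-th parts
of the circle, so that summing over them gives a Riemann sum. The starting point
th is a q-th part of the circle plus an offset s in [0, 1/q]. *)
Lemma rational_orbit_dist (q : nat) (p : int) (th : R) : (0 < q)%N -> coprimez p q ->
  `|\sum_(k < q) F (th + k%:R * (p%:~R / q%:R)) - q%:R * I| <= L.
Proof.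
move=> q0 cpq; have q0' : 0 < q%:R :> R by rewrite ltr0n.
have qz : q%:Z != 0 by rewrite eqz_nat -lt0n.
set c := Num.floor (q%:R * th); set s := th - c%:~R / q%:R.
have s0 : 0 <= s <= q%:R^-1.
  have := floor_le_tmp (q%:R * th); have := floorD1_gt (q%:R * th).
  rewrite intrD -/c => h1 h2; rewrite /s subr_ge0 ler_pdivrMr// [th * _]mulrC h2/=.
  rewrite lerBlDr (_ : q%:R^-1 + c%:~R / q%:R = (1 + c%:~R) / q%:R); last by rewrite mulrDl mul1r.
  rewrite ler_pdivlMr// [th * _]mulrC; lra.
pose m (k : nat) := ((c + k%:Z * p) %% q)%Z.
have m0 k : 0 <= m k by rewrite modz_ge0.
have ltm k : (absz (m k) < q)%N by rewrite -ltz_nat gez0_abs// ltz_mod.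
pose sg (k : 'I_q) := Ordinal (ltm k).
have sg_inj : injective sg.
  move=> i j /(congr1 val) /= /(congr1 Posz); rewrite !gez0_abs// => /eqP.
  rewrite eqz_mod_dvd (_ : _ - _ = (i%:Z - j%:Z) * p); last by ring.
  rewrite Gauss_dvdzl; last by rewrite coprimez_sym.
  rewrite dvdzE /= => dv; apply: val_inj => /=; apply/eqP.
  case/dvdnP: dv => -[|n] e; first by move: e; lia.
  have := ltn_ord i; have := ltn_ord j.
  have : (q <= absz (i%:Z - j%:Z))%N by rewrite e mulSn leq_addr.
  by lia.
rewrite (eq_bigr (fun k => F (s + (sg k)%:R / q%:R))); last first.
  move=> k _; rewrite -[RHS](Fper _ ((c + (k : nat)%:Z * p) %/ q)%Z); congr F.
  have sgE : (sg k)%:R = (m k)%:~R :> R by rewrite pmulrn /= gez0_abs.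
  have : c + (k : nat)%:Z * p = ((c + (k : nat)%:Z * p) %/ q)%Z * q%:Z + m k.
    exact: divz_eq.
  rewrite sgE; move: (m k) (_ %/ _)%Z => M D /(congr1 (fun z : int => z%:~R : R)).
  rewrite !intrD !intrM -!pmulrn => e.
  have -> : M%:~R = c%:~R + k%:R * p%:~R - D%:~R * q%:R :> R by rewrite e; ring.
  by rewrite /s; field; rewrite gt_eqF.
rewrite -(reindex_inj sg_inj (P := xpredT) (F := fun j : 'I_q => F (s + j%:R / q%:R)))/=.
apply: (@riemann_sum_dist q (fun j => s + j%:R / q%:R)) => // j jq.
case/andP: s0 => s0 s1.
by rewrite lerDr s0 -natr1 mulrDl mul1r addrC lerD2l.
Qed.

Lemma Rintegral_unit_bounded : `|I| <= B.
Proof.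
have h c : leb.-integrable `[0, 1] (EFin \o cst (c : R)).
  apply: continuous_compact_integrable; first exact: segment_compact.
  by apply: continuous_subspaceT => ?; exact: cvg_cst.
have int_cst (c : R) : \int[leb]_(x in `[0, 1]) c = c.
  rewrite Rintegral_cst// [X in fine X](_ : _ = 1%E) /= ?mulr1//.
  by rewrite [LHS]lebesgue_measure_itv/= lte_fin ltr01 oppr0 adde0.
have i := lip_integrable 0 1.
rewrite ler_norml; apply/andP; split.
  rewrite -[leLHS]int_cst; apply: le_Rintegral => //; first exact: h.
  by move=> x _; have := FB x; rewrite ler_norml => /andP[].
rewrite -[leRHS]int_cst; apply: le_Rintegral => //; first exact: h.
by move=> x _; have := FB x; rewrite ler_norml => /andP[].
Qed.

Section Drift.
Variables (W dl eta : R) (q : nat) (p : int).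
Hypotheses (q0 : (0 < q)%N) (cpq : coprimez p q) (hqp : `|q%:R * W - p%:~R| <= eta).

Lemma drift_dist (l : nat -> R) (S : nat) :
  (forall k, (k.+1 < S)%N -> `|l k.+1 - l k - W| <= dl) ->
  forall k, (k < S)%N -> `|l k - (l 0%N + k%:R * W)| <= k%:R * dl.
Proof.
move=> hl; elim=> [|k IH] kS; first by rewrite !mul0r addr0 subrr normr0.
rewrite [X in `|X|](_ : _ = (l k.+1 - l k - W) + (l k - (l 0%N + k%:R * W))); last by rewrite -natr1; ring.
rewrite [leRHS](_ : _ = dl + k%:R * dl); last by rewrite -natr1; ring.
by apply: le_trans (ler_normD _ _) _; apply: lerD; [exact: hl|exact/IH/ltnW].
Qed.

(** Over q steps the sequence stays within q dl of a rotation by W, and the rotation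
by W within eta of the rotation by p/q. *)
Lemma drift_block_dist (l : nat -> R) : 0 <= dl ->
  (forall k, (k.+1 < q)%N -> `|l k.+1 - l k - W| <= dl) ->
  `|\sum_(k < q) F (l k) - q%:R * I| <= L + q%:R * (L * (q%:R * dl + eta)).
Proof.
move=> dl0 hl; have q0' : 0 < q%:R :> R by rewrite ltr0n.
have := rational_orbit_dist (l 0%N) q0 cpq.
set T := \sum_(k < q) _ => hT.
rewrite [X in `|X|](_ : _ = (T - q%:R * I) + \sum_(k < q) (F (l k) - F (l 0%N + k%:R * (p%:~R / q%:R)))); last first.
  by rewrite sumrB -/T; ring.
apply: le_trans (ler_normD _ _) _; apply: lerD => //.
apply: le_trans (ler_norm_sum _ _ _) _.
apply: (@le_trans _ _ (\sum_(k < q) L * (q%:R * dl + eta))); last first.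
  by rewrite sumr_const card_ord -[leLHS]mulr_natl.
apply: ler_sum => k _; apply: le_trans (Flip _ _) _; rewrite ler_wpM2l//.
rewrite [X in `|X|](_ : _ = (l k - (l 0%N + (k : nat)%:R * W)) + k%:R / q%:R * (q%:R * W - p%:~R)); last first.
  by field; rewrite gt_eqF.
have kq : (k : nat)%:R <= q%:R :> R by rewrite ler_nat ltnW.
apply: le_trans (ler_normD _ _) _; apply: lerD.
  apply: le_trans (drift_dist hl (ltn_ord k)) _; by rewrite ler_wpM2r.
rewrite normrM; apply: le_trans hqp; rewrite ler_piMl//.
by rewrite ger0_norm ?divr_ge0// ler_pdivrMr// mul1r.
Qed.

(** Cutting the orbit into blocks of length q, each block is nearly a Riemann
sum; the incomplete last block costs at most 2 q B. The bound is
linear in L and B, so it carries over to families of functions on which L and B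
are proportional to a common weight. *)
Lemma drift_equidistribution (l : nat -> R) (S : nat) : 0 <= dl ->
  (forall k, (k.+1 < S)%N -> `|l k.+1 - l k - W| <= dl) ->
  `|\sum_(k < S) F (l k) - S%:R * I| <=
    S%:R * (L * (q%:R^-1 + q%:R * dl + eta)) + 2 * q%:R * B.
Proof.
move=> dl0; have q0' : 0 < q%:R :> R by rewrite ltr0n.
have IB := Rintegral_unit_bounded.
have B0 : 0 <= B by exact: le_trans (FB 0).
have eta0 : 0 <= eta by exact: le_trans hqp.
rewrite (divn_eq S q); move: (S %/ q)%N (S %% q)%N (ltn_mod S q) => n r.
rewrite q0 => rq; elim: n l => [|n IH] l hl.
  rewrite mul0n add0n; apply: (@le_trans _ _ (2 * q%:R * B)); last first.
    by rewrite lerDr !mulr_ge0// !addr_ge0// ?mulr_ge0// ?invr_ge0// ltW.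
  apply: le_trans (ler_normB _ _) _.
  apply: (@le_trans _ _ (r%:R * B + r%:R * B)).
    apply: lerD; last by rewrite normrM normr_nat ler_wpM2l.
    apply: le_trans (ler_norm_sum _ _ _) _.
    apply: (@le_trans _ _ (\sum_(k < r) B)); first exact: ler_sum.
    by rewrite sumr_const card_ord -[leLHS]mulr_natl.
  by rewrite -mulrDl -mulr2n -[_ *+ 2]mulr_natl ler_wpM2r// ler_wpM2l// ler_nat ltnW.
have := IH (fun k => l (q + k)%N); have := @drift_block_dist l dl0.
set m := (n * q + r)%N.
have -> : (n.+1 * q + r)%N = (q + m)%N by rewrite mulSn addnA.
move=> h1 h2.
have {}h1 : `|\sum_(k < q) F (l k) - q%:R * I| <= q%:R * (L * (q%:R^-1 + q%:R * dl + eta)).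
  rewrite (_ : q%:R * _ = L + q%:R * (L * (q%:R * dl + eta))); last by field; rewrite gt_eqF.
  by apply: h1 => k kq; apply: hl; rewrite -/m mulSn -addnA (leq_trans kq)// leq_addr.
have {}h2 : `|\sum_(k < m) F (l (q + k)%N) - m%:R * I| <=
    m%:R * (L * (q%:R^-1 + q%:R * dl + eta)) + 2 * q%:R * B.
  by apply: h2 => k km; rewrite addnS; apply: hl; rewrite mulSn -addnA -addnS ltn_add2l.
rewrite big_split_ord /= natrD.
rewrite [X in `|X|](_ : _ = (\sum_(k < q) F (l k) - q%:R * I) +
   (\sum_(k < m) F (l (q + k)%N) - m%:R * I)); last by ring.
apply: le_trans (ler_normD _ _) _.
by rewrite mulrDl -addrA; exact: lerD.
Qed.

End Drift.

End Equidistribution.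

(** * Iterated limits *)

Section Limsup.
Context {R : realType}.
Local Open Scope ereal_scope.

Lemma limf_esup_lt_near (T : choiceType) (X : filteredType T) (f : X -> \bar R)
    (F : set_system X) (FF : Filter F) (c : \bar R) :
  limf_esup f F < c -> \forall x \near F, f x < c.
Proof.
rewrite limf_esupE => /ereal_inf_lt[_ [V FV <-] sc].
apply: filterS FV => x Vx; apply: le_lt_trans sc.
by apply: ereal_sup_ubound; exists x.
Qed.

Lemma limf_esup_le_near (T : choiceType) (X : filteredType T) (f : X -> \bar R)
    (F : set_system X) (c : \bar R) :
  (\forall x \near F, f x <= c) -> limf_esup f F <= c.
Proof.
move=> h; rewrite limf_esupE; apply: (@le_trans _ _ (ereal_sup (f @` [set x | f x <= c]))).
  by apply: ereal_inf_lbound; exists [set x | f x <= c].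
by apply: ge_ereal_sup => _ [x xc <-].
Qed.

Lemma limsup2_lt_near (a : nat -> R -> \bar R) c : limsup2 a < c ->
  \forall e \near (0:R)^'+, \forall N \near \oo, a N e < c.
Proof.
by move/limf_esup_lt_near; apply: filterS => e; exact: limf_esup_lt_near.
Qed.

Lemma near_vanishes (a : nat -> R -> \bar R) :
  (forall z : R, (0 < z)%R -> \forall e \near (0:R)^'+, \forall N \near \oo, `|a N e| <= z%:E) ->
  vanishes a.
Proof.
move=> h; apply/eqP; rewrite eq_le; apply/andP; split; last first.
  apply: limf_esup_ge0 => [|e]; first exact: filter_not_empty.
  by apply: limf_esup_ge0 => //; exact: filter_not_empty.
apply/lee_addgt0Pr => z z0; rewrite add0e.
apply: limf_esup_le_near; apply: filterS (h _ z0) => e.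
exact: limf_esup_le_near.
Qed.

End Limsup.

Section Iterated.
Context {R : realType}.

Lemma iterated_limit_near (a : nat -> R -> R) (l : R) :
  (\forall e \near 0^'+, cvgn (a ^~ e)) ->
  limn (a ^~ e) @[e --> 0^'+] --> l ->
  forall z : R, 0 < z -> \forall e \near 0^'+, \forall N \near \oo, `|a N e - l| <= z.
Proof.
move=> inner outer z z0.
have z2 : 0 < z / 2 by rewrite divr_gt0.
have h := cvgr_dist_le _ _ outer _ z2.
near=> e.
have ce : cvgn (a ^~ e) by near: e.
have le : `|l - limn (a ^~ e)| <= z / 2 by near: e; exact: h.
near=> N.
have hN : `|limn (a ^~ e) - a N e| <= z / 2 by near: N; exact: (cvgr_dist_le _ _ ce _ z2).
rewrite (_ : _ - l = - (l - limn (a ^~ e)) - (limn (a ^~ e) - a N e)); last by ring.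
by apply: le_trans (ler_normB _ _) _; rewrite normrN; lra.
Unshelve. all: by end_near. Qed.

End Iterated.

(** * Estimates on one block *)

Section BlockEstimates.
Context {R : realType}.

(** The biases b telescope, so they contribute 2 B / D to the average bm. The
increments om vary by at most S C / N over the block, which is of order C e, and
S / D differs from 1 by at most 1 / D; the latter error is multiplied by the size
of om, which is in turn controlled by that of bm. Indices start at 1 because
om k.+1 stands for the increment from step k to step k.+1. *)
Lemma block_increment_dist (om b : nat -> R) (S : nat) (N e C B : R) :
  let D := 2 * N * e in
  let bm := D^-1 * \sum_(k < S) (om k.+1 + (b k.+1 - b k)) in
  0 < N -> 0 < e -> 0 <= C -> 2 <= D -> `|S%:R - D| <= 1 -> (forall k, `|b k| <= B) ->
  (forall k, (k.+1 < S)%N -> N * `|om k.+2 - om k.+1| <= C) ->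
  forall k, (k < S)%N -> `|om k.+1 - bm| <= 10 * C * e + (4 * B + 2 * `|bm|) / D.
Proof.
move=> D bm N0 e0 C0 D2 SD bB homC k kS.
have D0 : 0 < D by lra.
have step j i : (j + i < S)%N -> `|om (j + i).+1 - om j.+1| <= i%:R * (C / N).
  elim: i => [|i IH] ji; first by rewrite addn0 subrr normr0 mul0r.
  rewrite addnS in ji *.
  rewrite [X in `|X|](_ : _ = (om (j + i).+2 - om (j + i).+1) + (om (j + i).+1 - om j.+1)); last by ring.
  rewrite [leRHS](_ : _ = C / N + i%:R * (C / N)); last by rewrite -natr1; ring.
  apply: le_trans (ler_normD _ _) _; apply: lerD; last exact/IH/ltnW.
  by rewrite ler_pdivlMr// mulrC homC.
have CN0 : 0 <= C / N by rewrite divr_ge0// ltW.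
have far j : (j < S)%N -> `|om j.+1 - om k.+1| <= S%:R * (C / N).
  move=> jS; have [jk|kj] := leqP j k.
    rewrite distrC -(subnKC jk); apply: le_trans (step _ _ _) _; first by rewrite subnKC.
    by rewrite ler_wpM2r// ler_nat (leq_trans (leq_subr _ _))// ltnW.
  rewrite -(subnKC (ltnW kj)); apply: le_trans (step _ _ _) _; first by rewrite subnKC// ltnW.
  by rewrite ler_wpM2r// ler_nat (leq_trans (leq_subr _ _))// ltnW.
have tel : \sum_(j < S) (b j.+1 - b j) = b S - b 0%N.
  by rewrite -(big_mkord xpredT (fun j => b j.+1 - b j)) telescope_sumr.
have Dbm : D * bm = \sum_(j < S) om j.+1 + (b S - b 0%N).
  by rewrite /bm mulrA divff ?gt_eqF// mul1r big_split /= tel.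
have main : `|D * bm - S%:R * om k.+1| <= S%:R * (S%:R * (C / N)) + 2 * B.
  rewrite Dbm addrAC; apply: le_trans (ler_normD _ _) _; apply: lerD; last first.
    by apply: le_trans (ler_normB _ _) _; have := bB S; have := bB 0%N; lra.
  have -> : S%:R * om k.+1 = \sum_(j < S) om k.+1 by rewrite sumr_const card_ord mulr_natl.
  rewrite -sumrB; apply: le_trans (ler_norm_sum _ _ _) _.
  apply: (@le_trans _ _ (\sum_(j < S) S%:R * (C / N))); first by apply: ler_sum => j _; exact: far.
  by rewrite sumr_const card_ord -[leLHS]mulr_natl.
have S1 : S%:R <= 3 / 2 * D by move: SD; rewrite ler_norml; lra.
have SS : S%:R * (S%:R * (C / N)) <= 5 * C * e * D.
  rewrite mulrA; apply: (@le_trans _ _ (9 / 4 * D ^+ 2 * (C / N))).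
    rewrite ler_wpM2r//; apply: (@le_trans _ _ ((3 / 2 * D) * (3 / 2 * D))); first exact: ler_pM.
    by rewrite le_eqVlt; apply/orP; left; apply/eqP; field.
  rewrite (_ : 9 / 4 * D ^+ 2 * (C / N) = 9 / 2 * (C * e) * D); last by rewrite /D; field; rewrite gt_eqF.
  have : 0 <= C * e * D by rewrite !mulr_ge0// ltW.
  by lra.
have d1 : D * `|om k.+1 - bm| <= 5 * C * e * D + 2 * B + `|om k.+1|.
  rewrite -{1}(gtr0_norm D0) -normrM.
  rewrite [X in `|X|](_ : _ = - (D * bm - S%:R * om k.+1) - (S%:R - D) * om k.+1); last by ring.
  apply: le_trans (ler_normB _ _) _; rewrite normrN; apply: lerD; first by lra.
  by rewrite normrM ler_piMl.
have d2 : `|om k.+1| <= `|bm| + `|om k.+1 - bm|.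
  rewrite [X in `|X| <= _](_ : _ = bm + (om k.+1 - bm)); last by ring.
  exact: ler_normD.
rewrite -(ler_pM2l D0) mulrDr [D * (_ / D)]mulrCA divff ?gt_eqF// mulr1.
have := normr_ge0 (om k.+1 - bm); nra.
Qed.

End BlockEstimates.

Section MuInf.
Context {R : realType}.
Variables (K M C : R).
Hypothesis C0 : 0 <= C.
Hypothesis muC : forall omega lam n, `|omega| <= M ->
     mu K omega lam n <= C * weight K n.
Hypothesis muL : forall omega omega' lam lam' n, `|omega| <= M -> `|omega'| <= M ->
     `|mu K omega lam n - mu K omega' lam' n| <=
       C * (`|omega - omega'| + `|lam - lam'|) * weight K n.

Let Lip om n : `|om| <= M -> forall x y, `|mu K om x n - mu K om y n| <= C * weight K n * `|x - y|.
Proof.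
move=> omM x y; apply: le_trans (muL x y n omM omM) _.
by rewrite subrr normr0 add0r mulrAC.
Qed.

Let Bd om n : `|om| <= M -> forall x, `|mu K om x n| <= C * weight K n.
Proof. by move=> omM x; rewrite ger0_norm ?mu_ge0// muC. Qed.

Let Cg0 n : 0 <= C * weight K n. Proof. by rewrite mulr_ge0 ?expR_ge0. Qed.

Lemma mu_inf_ge0 om n : 0 <= mu_inf K om n.
Proof. by apply: Rintegral_ge0 => x _; exact: mu_ge0. Qed.

Lemma mu_inf_le om n : `|om| <= M -> mu_inf K om n <= C * weight K n.
Proof.
move=> omM; rewrite -[leLHS]ger0_norm ?mu_inf_ge0//.
exact: (Rintegral_unit_bounded (Cg0 n) (Lip n omM) (Bd n omM)).
Qed.

(** The error has three parts: freezing the increments om at their average bm, the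
equidistribution of lm for the frozen function, and the difference between the
number S of sites and the normalisation D. *)
Lemma block_mu_dist (om lm : nat -> R) (S q : nat) (p : int) (D bm W dl dl1 eta : R) (n : int) :
  2 <= D -> `|S%:R - D| <= 1 -> (0 < q)%N -> coprimez p q -> `|q%:R * W - p%:~R| <= eta ->
  (forall k, om k.+1 = lm k.+1 - lm k) ->
  `|bm| <= M -> (forall k, (k < S)%N -> `|om k.+1| <= M) ->
  (forall k, (k < S)%N -> `|om k.+1 - bm| <= dl) -> 0 <= dl -> `|bm - W| <= dl1 ->
  `|D^-1 * (\sum_(k < S) mu K (om k.+1) (lm k.+1) n) - mu_inf K bm n| <=
    C * weight K n * (2 * dl + 2 * (q%:R^-1 + q%:R * (dl + dl1) + eta) + (2 * q%:R + 1) / D).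
Proof.
move=> D2 SD q0 cpq hqp omE bmM omM omdl dl0 bmW.
have D0 : 0 < D by lra.
have dl10 : 0 <= dl1 by exact: le_trans bmW.
have eta0 : 0 <= eta by exact: le_trans hqp.
set I := mu_inf K bm n; set A := C * weight K n.
have A0 : 0 <= A := Cg0 n.
have hI : `|I| <= A by rewrite ger0_norm ?mu_inf_ge0// mu_inf_le.
have per x (c : int) : mu K bm (x + c%:~R) n = mu K bm x n by exact: mu_periodic.
have eqd := drift_equidistribution A0 (Lip n bmM) per (Bd n bmM) q0 cpq hqp
   (l := fun k => lm k.+1) (S := S) (dl := dl + dl1).
have {}eqd : `|\sum_(k < S) mu K bm (lm k.+1) n - S%:R * I| <=
   S%:R * (A * (q%:R^-1 + q%:R * (dl + dl1) + eta)) + 2 * q%:R * A.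
  apply: eqd; first by rewrite addr_ge0.
  move=> k kS; rewrite -omE.
  rewrite [X in `|X|](_ : _ = (om k.+2 - bm) + (bm - W)); last by ring.
  by apply: le_trans (ler_normD _ _) _; apply: lerD => //; exact: omdl.
have frz : `|\sum_(k < S) mu K (om k.+1) (lm k.+1) n - \sum_(k < S) mu K bm (lm k.+1) n| <= S%:R * (A * dl).
  rewrite -sumrB; apply: le_trans (ler_norm_sum _ _ _) _.
  apply: (@le_trans _ _ (\sum_(k < S) A * dl)); last by rewrite sumr_const card_ord -[leLHS]mulr_natl.
  apply: ler_sum => k _; apply: le_trans (muL _ _ _ _ _) _ => //; first exact: omM.
  rewrite subrr normr0 addr0 /A [leRHS]mulrAC ler_wpM2r ?expR_ge0// ler_wpM2l//; exact: omdl.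
have S2 : S%:R <= 2 * D by move: SD; rewrite ler_norml; lra.
set T := \sum_(k < S) mu K (om k.+1) (lm k.+1) n in frz *.
set T' := \sum_(k < S) mu K bm (lm k.+1) n in frz eqd *.
rewrite -(ler_pM2l D0) -{1}(gtr0_norm D0) -normrM.
rewrite [X in `|X|](_ : _ = (T - T') + (T' - S%:R * I) + (S%:R - D) * I); last by field; rewrite gt_eqF.
have -> : D * (A * (2 * dl + 2 * (q%:R^-1 + q%:R * (dl + dl1) + eta) + (2 * q%:R + 1) / D)) =
   2 * D * (A * dl) + (2 * D * (A * (q%:R^-1 + q%:R * (dl + dl1) + eta)) + 2 * q%:R * A) + A.
  by field; rewrite pnatr_eq0 -lt0n q0 gt_eqF.
have u1 : 0 <= A * dl by rewrite mulr_ge0.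
have u2 : 0 <= A * (q%:R^-1 + q%:R * (dl + dl1) + eta).
  by rewrite mulr_ge0// !addr_ge0// mulr_ge0// addr_ge0.
apply: le_trans (ler_normD _ _) _; apply: lerD; last first.
  by rewrite normrM -[leRHS]mul1r ler_pM.
apply: le_trans (ler_normD _ _) _; apply: lerD.
  by apply: le_trans frz _; rewrite ler_wpM2r.
by apply: le_trans eqd _; rewrite lerD2r ler_wpM2r.
Qed.

End MuInf.

(** * Expectations of block averages *)

Section Weights.
Context {R : realType}.
Implicit Types (K omega lam : R) (f : int -> R).

Lemma zfin_mul_mu K omega lam f : 0 < K -> zfin (fun n => `|f n| * weight K n) ->
  zfin (fun n => `|f n| * mu K omega lam n).
Proof.
move=> K0 ff; have [C C0 [hC _]] := mu_reg K0 (normr_ge0 omega).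
apply: (@zfin_le _ _ (fun n => C * (`|f n| * weight K n))).
  by move=> n; rewrite mulrCA ler_wpM2l// hC.
by apply: zfinZl => // n; rewrite mulr_ge0 ?expR_ge0.
Qed.

Lemma gauss_thirdE K (n : int) : - K * n%:~R ^+ 2 / 3 = - (K / 3) * (n%:~R - 0) ^+ 2.
Proof. by rewrite subr0; field. Qed.

Lemma zfin_id_gauss K : 0 < K -> zfin (fun n : int => `|n%:~R| * weight K n).
Proof.
move=> K0; under eq_fun do rewrite gauss_thirdE -[X in `|X|]subr0.
by apply: zfin_norm_gauss; rewrite divr_gt0.
Qed.

Lemma L1_zfin K f : 0 < K -> L1_gauss_third K f -> zfin (fun n => `|f n| * weight K n).
Proof.
move=> K0; rewrite /L1_gauss_third /gauss_third.
have fg : zfin (fun n : int => weight K n).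
  under eq_fun do rewrite gauss_thirdE.
  by apply: zfin_gauss_at; rewrite divr_gt0.
set Z := fine _.
have Z0 : 0 < Z.
  apply: lt_le_trans (zsum_ge_term 0 _ fg); first exact: expR_gt0.
  by move=> n; exact: expR_ge0.
move=> hf; have {}hf : zfin (fun n => `|f n| * weight K n / Z).
  apply: le_lt_trans hf; apply: le_esum => n _; rewrite lee_fin.
  by rewrite -mulrA normrM [`|_ / Z|]ger0_norm// divr_ge0 ?expR_ge0// ltW.
have := zfinZl (ltW Z0) _ hf; rewrite (_ : (fun m => _) = (fun n => `|f n| * weight K n)).
  by apply => n; rewrite divr_ge0 ?mulr_ge0 ?expR_ge0// ltW.
by apply/funext => n; rewrite mulrC divfK// gt_eqF.
Qed.

Lemma zsum_mu K omega lam : 0 < K -> zsum (mu K omega lam) = 1.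
Proof.
move=> K0; have := zsum_diff_law (rho_ge0 (lam - omega) ^~ K0) (rho_ge0 lam ^~ K0)
  (zfin_rho _ K0) (zfin_rho _ K0).
by rewrite !zsum_rho// mulr1.
Qed.

Lemma zfin_mu K omega lam : 0 < K -> zfin (mu K omega lam).
Proof.
move=> K0; exact: (zfin_diff_law (rho_ge0 (lam - omega) ^~ K0) (rho_ge0 lam ^~ K0)
  (zfin_rho _ K0) (zfin_rho _ K0)).
Qed.

(** The law mu has mass 1, so the mean of n is omega plus that of n - omega. *)
Lemma mu_mean K omega lam : 0 < K ->
  zsum (fun n => pospart n%:~R * mu K omega lam n) - zsum (fun n => pospart (- n%:~R) * mu K omega lam n) =
  omega + (bias K lam - bias K (lam - omega)).
Proof.
move=> K0; rewrite -mu_bias//; set m := mu K omega lam.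
have m0 n : 0 <= m n by exact: mu_ge0.
have fm : zfin m by exact: zfin_mu.
have sm : zsum m = 1 by exact: zsum_mu.
have fb (h v : int -> R) : zfin (fun n => `|v n| * m n) -> (forall n, h n <= `|v n|) -> zfin (fun n => h n * m n).
  by move=> fv hv; apply: zfin_le fv => n; rewrite ler_wpM2r.
have fn : zfin (fun n => `|n%:~R| * m n) by exact/zfin_mul_mu/zfin_id_gauss.
have fo : zfin (fun n => `|n%:~R - omega| * m n).
  by have := zfin_mu_norm omega lam K0; under eq_fun do rewrite mulrC.
have f1 : zfin (fun n => pospart n%:~R * m n) by apply: fb fn _ => n; exact: pospart_le_norm.
have f2 : zfin (fun n => pospart (- n%:~R) * m n).
  by apply: fb fn _ => n; rewrite -[leRHS]normrN pospart_le_norm.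
have f3 : zfin (fun n => m n * pospart (n%:~R - omega)).
  by under eq_fun do rewrite mulrC; apply: fb fo _ => n; exact: pospart_le_norm.
have f4 : zfin (fun n => m n * pospart (- (n%:~R - omega))).
  by under eq_fun do rewrite mulrC; apply: fb fo _ => n; rewrite -[leRHS]normrN pospart_le_norm.
have n1 n : 0 <= pospart n%:~R * m n by rewrite mulr_ge0 ?pospart_ge0.
have n2 n : 0 <= pospart (- n%:~R) * m n by rewrite mulr_ge0 ?pospart_ge0.
have n3 n : 0 <= m n * pospart (n%:~R - omega) by rewrite mulr_ge0 ?pospart_ge0.
have n4 n : 0 <= m n * pospart (- (n%:~R - omega)) by rewrite mulr_ge0 ?pospart_ge0.
have c0 (c : R) n : 0 <= pospart c * m n by rewrite mulr_ge0 ?pospart_ge0.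
have cf (c : R) : zfin (fun n => pospart c * m n) by apply: zfinZl => //; exact: pospart_ge0.
have cs (c : R) : zsum (fun n => pospart c * m n) = pospart c by rewrite zsumZl ?pospart_ge0// sm mulr1.
have e : zsum (fun n => pospart n%:~R * m n + m n * pospart (- (n%:~R - omega)) + pospart (- omega) * m n) =
   zsum (fun n => pospart (- n%:~R) * m n + m n * pospart (n%:~R - omega) + pospart omega * m n).
  congr zsum; apply/funext => n; rewrite ![m n * _]mulrC -!mulrDl; congr (_ * _).
  have := pospartBN (n%:~R : R); have := pospartBN (n%:~R - omega); have := pospartBN omega; lra.
have := e; rewrite !zsumD// ?cs; try exact: zfinD; try by move=> n; rewrite addr_ge0.
have := pospartBN omega; lra.
Qed.

End Weights.

Section Block.
Context {R : realType}.
Variables (d : measure_display) (T : measurableType d) (P : probability T R).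
Variables (K : R) (w : int -> T -> int) (lam : int -> R).
Hypothesis K0 : 0 < K.
Hypothesis mw : forall i n, measurable (w i @^-1` [set n]).
Hypothesis law : forall i n, P (w i @^-1` [set n]) = (mu K (increment lam i) (lam i) n)%:E.
Variables (N : nat) (x e : R) (a : int) (S : nat).
Hypothesis sumS : forall u : int -> R, \sum_(i \in sites N x e) u i = \sum_(k < S) u (a + k%:Z).

Let m k := mu K (increment lam (a + (k : nat)%:Z)) (lam (a + k%:Z)).

Lemma expectation_block (f : int -> R) : zfin (fun n => `|f n| * weight K n) ->
  ('E_P[fun om => block_avg N x e (fun i => f (w i om))] =
   ((2 * N%:R * e)^-1 * \sum_(k < S)
     (zsum (fun n => pospart (f n) * m k n) - zsum (fun n => pospart (- f n) * m k n)))%:E)%E.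
Proof.
move=> ff.
have fi i : zfin (fun n => `|f n| * mu K (increment lam i) (lam i) n) by exact: zfin_mul_mu.
have int i : P.-integrable [set: T] (EFin \o (fun om => f (w i om))).
  exact: (integrable_int (mw i) (law i) (fi i)).
rewrite unlock.
under eq_integral do rewrite /block_avg sumS EFinM -sumEFin.
rewrite integralZl//; last by apply: integrable_sum => // k _; exact: int.
rewrite integral_sum//; last by move=> k; exact: int.
rewrite EFinM -sumEFin; congr (_ * _)%E; apply: eq_bigr => k _.
by have := expectation_int (mw _) (law (a + (k : nat)%:Z)) (fi _); rewrite unlock.
Qed.

Lemma block_meanE :
  block_mean P N w x e = (2 * N%:R * e)^-1 * \sum_(k < S)
    (increment lam (a + k%:Z) + (bias K (lam (a + k%:Z)) - bias K (lam (a + k%:Z - 1)))).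
Proof.
rewrite /block_mean (@expectation_block (fun n => n%:~R)) /=; last exact: zfin_id_gauss.
congr (_ * _); apply: eq_bigr => k _; rewrite mu_mean//; congr (_ + (_ - bias _ _)).
by rewrite /increment; ring.
Qed.

Lemma zsum_sum (f : int -> R) : (forall n, 0 <= f n) -> zfin (fun n => `|f n| * weight K n) ->
  zfin (fun n => f n * \sum_(k < S) m k n) /\
  \sum_(k < S) zsum (fun n => f n * m k n) = zsum (fun n => f n * \sum_(k < S) m k n).
Proof.
move=> f0 ff.
have fk k : zfin (fun n => f n * m k n).
  apply: zfin_le (zfin_mul_mu (increment lam (a + k%:Z)) (lam (a + k%:Z)) K0 ff) => n.
  by rewrite ler_wpM2r ?mu_ge0// ler_norm.
have m0 k n : 0 <= m k n by exact: mu_ge0.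
elim: S => [|s [IHf IH]].
  have -> : (fun n => f n * \sum_(k < 0) m k n) = (fun=> 0).
    by apply/funext => n; rewrite big_ord0 mulr0.
  have z : (\esum_(n in [set: int]) (0 : R)%:E = 0)%E by rewrite esum1.
  split; first by rewrite /zfin z.
  by rewrite big_ord0 /zsum z.
have -> : (fun n => f n * \sum_(k < s.+1) m k n) =
    (fun n => f n * \sum_(k < s) m k n + f n * m s n).
  by apply/funext => n; rewrite big_ord_recr mulrDr.
rewrite big_ord_recr /= IH.
have n1 n : 0 <= f n * \sum_(i < s) m i n by rewrite mulr_ge0// sumr_ge0.
have n2 n : 0 <= f n * m s n by rewrite mulr_ge0.
split; first exact: zfinD.
by rewrite zsumD.
Qed.

(** The positive and the negative part of f are treated separately, so that only
sums of non-negative terms are compared; this gives the factor 2. *)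
Lemma block_expectation_dist (f : int -> R) (c : R) : 0 <= e ->
  zfin (fun n => `|f n| * weight K n) -> 0 <= c ->
  (forall n, `| block_avg N x e (fun i => mu K (increment lam i) (lam i) n)
          - mu_inf K (block_mean P N w x e) n | <= c * weight K n) ->
  (`| 'E_P[fun om => block_avg N x e (fun i => f (w i om))]
        - mu_inf_mean K f (block_mean P N w x e) | <=
   (2 * c * zsum (fun n => `|f n| * weight K n))%:E)%E.
Proof.
move=> e0 ff c0 hc; set bm := block_mean P N w x e.
set D := (2 * N%:R * e)^-1.
have D0 : 0 <= D by rewrite invr_ge0 !mulr_ge0.
pose A n := block_avg N x e (fun i => mu K (increment lam i) (lam i) n).
have AE n : A n = D * \sum_(k < S) m k n by rewrite /A /block_avg sumS.
have A0 n : 0 <= A n by rewrite AE mulr_ge0// sumr_ge0// => *; exact: mu_ge0.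
have i0 n : 0 <= mu_inf K bm n by exact: mu_inf_ge0.
have [C C0 [hC hL]] := mu_reg K0 (normr_ge0 bm).
have iC n : mu_inf K bm n <= C * weight K n.
  exact: (mu_inf_le C0 hC hL).
have nn n : 0 <= `|f n| * weight K n by rewrite mulr_ge0 ?expR_ge0.
have part (h : int -> R) : (forall n, 0 <= h n <= `|f n|) ->
  [/\ zfin (fun n => h n * mu_inf K bm n),
   D * (\sum_(k < S) zsum (fun n => h n * m k n)) = zsum (fun n => h n * A n) &
   `|zsum (fun n => h n * A n) - zsum (fun n => h n * mu_inf K bm n)| <=
     c * zsum (fun n => `|f n| * weight K n)].
  move=> hf; have h0 n : 0 <= h n by case/andP: (hf n).
  have hn n : h n <= `|f n| by case/andP: (hf n).
  have fh : zfin (fun n => `|h n| * weight K n).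
    by apply: zfin_le ff => n; rewrite ler_wpM2r ?expR_ge0// ger0_norm.
  have [fs sE] := zsum_sum h0 fh.
  have s0 n : 0 <= h n * \sum_(k < S) m k n.
    by rewrite mulr_ge0// sumr_ge0// => *; exact: mu_ge0.
  have fI : zfin (fun n => h n * mu_inf K bm n).
    apply: (@zfin_le _ _ (fun n => C * (`|f n| * weight K n))); last exact: zfinZl.
    by move=> n; rewrite mulrCA; apply: ler_pM.
  have hA : (fun n => h n * A n) = (fun n => D * (h n * \sum_(k < S) m k n)).
    by apply/funext => n; rewrite AE mulrCA.
  have fA : zfin (fun n => h n * A n) by rewrite hA; exact: zfinZl.
  split => //; first by rewrite sE -zsumZl// hA.
  rewrite -zsumZl//; apply: zsum_dist => //; last exact: zfinZl.
  - by move=> n; rewrite mulr_ge0.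
  - by move=> n; rewrite mulr_ge0.
  move=> n; rewrite -mulrBr normrM (ger0_norm (h0 n)) [leRHS]mulrCA; apply: ler_pM => //; exact: hc.
have p1 n : 0 <= pospart (f n) <= `|f n| by rewrite pospart_ge0 pospart_le_norm.
have p2 n : 0 <= pospart (- f n) <= `|f n| by rewrite pospart_ge0 -[leRHS]normrN pospart_le_norm.
have [f1 e1 b1] := part _ p1; have [f2 e2 b2] := part _ p2.
rewrite expectation_block// sumrB mulrBr e1 e2.
have -> : mu_inf_mean K f bm =
    (zsum (fun n => pospart (f n) * mu_inf K bm n) - zsum (fun n => pospart (- f n) * mu_inf K bm n))%:E.
  rewrite /mu_inf_mean EFinB; congr (_ - _)%E; rewrite -zsumE//.
  - apply: eq_esum => n _; rewrite funeposE -EFin_max; congr EFin.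
    by rewrite /pospart maxr_pMl// mul0r.
  - by move=> n; rewrite mulr_ge0// pospart_ge0.
  - apply: eq_esum => n _; rewrite funenegE -EFinN -EFin_max; congr EFin.
    by rewrite /pospart maxr_pMl// mul0r mulNr.
  - by move=> n; rewrite mulr_ge0// pospart_ge0.
rewrite -EFinB lee_fin.
move: b1 b2; rewrite !ler_norml; lra.
Qed.

End Block.

(** * The two limits *)

Lemma lattice_periodic_mul (N : nat) (A : Type) (u : int -> A) (z i : int) :
  lattice_periodic N u -> u (i + z * N%:Z) = u i.
Proof.
move=> up.
have nat_case (n : nat) j : u (j + n%:Z * N%:Z) = u j.
  elim: n j => [|n IH] j; first by rewrite mul0r addr0.
  by rewrite intS mulrDl mul1r addrA IH up.
case: z => n; first exact: nat_case.
by rewrite -(nat_case n.+1) NegzE -addrA -mulrDl addNr mul0r addr0.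
Qed.

(** The laws are only given on the window 1 <= i <= N, while blocks near the ends of
the torus leave it. *)
Lemma lattice_window (N : nat) (i : int) : (0 < N)%N ->
  exists r z : int, i = r + z * N%:Z /\ 1 <= r <= N%:Z.
Proof.
move=> N0; exists (((i - 1) %% N%:Z)%Z + 1), ((i - 1) %/ N%:Z)%Z.
have := divz_eq (i - 1) N; have := modz_ge0 (i - 1) (d := N%:Z).
have := @ltz_mod (i - 1) N%:Z; lia.
Qed.

Unset Implicit Arguments.

Section Scales.
Context {R : realType}.
Variables (K : R) (d : nat -> measure_display) (Om : forall N, measurableType (d N)).
Variables (P : forall N, probability (Om N) R) (w : forall N, int -> Om N -> int).
Variables (lam : nat -> int -> R) (N0 : nat) (x W : R).
Hypothesis K0 : 0 < K.
Hypothesis mw : forall N i n, (N0 < N)%N -> measurable (w N i @^-1` [set n]).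
Hypothesis law : forall N i n, (N0 < N)%N ->
  P N (w N i @^-1` [set n]) = (mu K (increment (lam N) i) (lam N i) n)%:E.

Definition pmf_error N (e : R) n : R :=
  block_avg N x e (fun i => mu K (increment (lam N) i) (lam N i) n)
          - mu_inf K (block_mean (P N) N (w N) x e) n.

(** With N and e fixed only finitely many increments occur, so they are bounded;
the constant c is not controlled as N and e vary. *)
Lemma pmf_error_bounded N e : (N0 < N)%N -> 0 < e ->
  exists c, forall n, `|pmf_error N e n| <= c * weight K n.
Proof.
move=> NN0 e0; have N_gt0 := leq_trans (ltn0Sn N0) NN0.
have [a [S [_ _ sumS]]] := sites_interval x N_gt0 e0.
rewrite /pmf_error; set bm := block_mean _ _ _ _ _.
set inc := increment (lam N).
pose M := `|bm| + \sum_(k < S) `|inc (a + k%:Z)|.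
have s0 : 0 <= \sum_(k < S) `|inc (a + k%:Z)| by exact: sumr_ge0.
have bmM : `|bm| <= M by rewrite lerDl.
have incM (k : 'I_S) : `|inc (a + (k : nat)%:Z)| <= M.
  by rewrite ler_wpDl// (bigD1 k)//= lerDl sumr_ge0.
have M0 : 0 <= M by exact: le_trans bmM.
have [C C0 [hC hL]] := mu_reg K0 M0.
set D := (2 * N%:R * e)^-1.
have D0 : 0 <= D by rewrite invr_ge0 !mulr_ge0// ltW.
exists (D * (S%:R * C) + C) => n; apply: le_trans (ler_normB _ _) _.
rewrite mulrDl; apply: lerD; last first.
  by rewrite ger0_norm ?mu_inf_ge0// (mu_inf_le C0 hC hL).
rewrite /block_avg sumS normrM (ger0_norm D0).
rewrite [leRHS](_ : _ = D * (S%:R * (C * weight K n))); last by ring.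
rewrite ler_wpM2l//.
apply: le_trans (ler_norm_sum _ _ _) _.
apply: (@le_trans _ _ (\sum_(k < S) C * weight K n)).
  by apply: ler_sum => k _; rewrite ger0_norm ?mu_ge0// hC.
by rewrite sumr_const card_ord -[leLHS]mulr_natl.
Qed.

Hypothesis W_irr : irrational W.
Hypothesis mean_near : forall z, 0 < z -> \forall e \near 0^'+, \forall N \near \oo,
  `|block_mean (P N) N (w N) x e - W| <= z.
Variable C : R.
Hypothesis C0 : 0 <= C.
Hypothesis reg_near : \forall e \near (0:R)^'+, \forall N \near \oo,
  forall i, sites N x e i -> N%:R * `|increment (lam N) (i + 1) - increment (lam N) i| <= C.

(** The order of the choices matters: the denominator q is fixed first, the
tolerance dl on the increments may then depend on q, the scale e on dl, and the
length 2 N e of the block on all of them. *)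
Lemma pmf_error_near z : 0 < z -> \forall e \near 0^'+, \forall N \near \oo,
  forall n, `|pmf_error N e n| <= z * weight K n.
Proof.
move=> z0.
have [B B0 hB] := bias_bounded K0.
have M0 : 0 <= `|W| + 2 by rewrite addr_ge0.
have [Cm Cm0 [hC hL]] := mu_reg K0 M0.
pose zeta := z / (Cm + 1).
have Cm1 : 0 < Cm + 1 by rewrite ltr_wpDl.
have zeta0 : 0 < zeta by rewrite divr_gt0.
have [Q0 hQ0] : exists Q0 : nat, 10 / zeta <= Q0%:R.
  exists (absz (Num.ceil (10 / zeta))); rewrite [leRHS]pmulrn gez0_abs ?ceil_ge//.
  by rewrite ceil_ge0 (lt_le_trans (ltrN10 _))// divr_ge0// ltW.
have [q [p [q0 Q0q cpq hqp]]] := irrational_approx Q0 W_irr (divr_gt0 zeta0 (ltr0n _ 10)).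
have q0' : 0 < q%:R :> R by rewrite ltr0n.
have iq : q%:R^-1 <= zeta / 10.
  rewrite -[zeta / 10]invrK lef_pV2 ?posrE ?invr_gt0 ?divr_gt0// invf_div.
  by apply: le_trans hQ0 _; rewrite ler_nat.
(* the common bound for |omega_i - E w| and |E w - W| *)
pose dl := Num.min 1 (zeta / (10 * (q%:R + 1))).
have q1 : 0 < 10 * (q%:R + 1) :> R by rewrite mulr_gt0// ltr_wpDl// ltW.
have dl0 : 0 < dl by rewrite lt_min ltr01 divr_gt0.
have dl1 : dl <= 1 by rewrite ge_min lexx.
have dlq : dl * (10 * (q%:R + 1)) <= zeta by rewrite -ler_pdivlMr// ge_min lexx orbT.
(* a lower bound for the length 2 N e of the block *)
pose X := 2 + 2 * (4 * B + 2 * (`|W| + 1)) / dl + 5 * (2 * q%:R + 1) / zeta.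
have e1 : 0 < dl / (20 * (C + 1)) by rewrite divr_gt0// mulr_gt0// ltr_wpDl.
near=> e.
have e0 : 0 < e by near: e; exact: nbhs_right_gt.
have eC : e * (20 * (C + 1)) <= dl.
  rewrite -ler_pdivlMr; last by rewrite mulr_gt0// ltr_wpDl.
  by near: e; exact: nbhs_right_le.
have mean_e : \forall N \near \oo, `|block_mean (P N) N (w N) x e - W| <= dl.
  by near: e; exact: mean_near.
have reg_e : \forall N \near \oo, forall i, sites N x e i ->
    N%:R * `|increment (lam N) (i + 1) - increment (lam N) i| <= C by near: e.
near=> N.
have NN0 : (N0 < N)%N by near: N; exact: nbhs_infty_gt.
have N_gt0 := leq_trans (ltn0Sn N0) NN0.
have bmW : `|block_mean (P N) N (w N) x e - W| <= dl by near: N.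
have reg : forall i, sites N x e i ->
    N%:R * `|increment (lam N) (i + 1) - increment (lam N) i| <= C by near: N.
have DX : X <= 2 * N%:R * e.
  have : X / (2 * e) <= N%:R by near: N; exact: nbhs_infty_ger.
  by rewrite ler_pdivrMr ?mulr_gt0// (_ : N%:R * _ = 2 * N%:R * e)//; ring.
have [a [S [SD sE sumS]]] := sites_interval x N_gt0 e0.
have N_gt0' : 0 < N%:R :> R by rewrite ltr0n.
move=> n; rewrite /pmf_error.
have bmE := block_meanE K0 (fun i n => mw N i n NN0) (fun i n => law N i n NN0) sumS.
set bm := block_mean _ _ _ _ _ in bmE bmW *; set D := 2 * N%:R * e in DX SD bmE.
pose lm k := lam N (a - 1 + (k : nat)%:Z).
pose om k := lm k - lm k.-1; pose b k := bias K (lm k).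
have lmE k : lam N (a + k%:Z) = lm k.+1 by rewrite /lm; congr (lam N _); rewrite intS; ring.
have lmE' k : lam N (a + k%:Z - 1) = lm k by rewrite /lm; congr (lam N _); ring.
have incE k : increment (lam N) (a + k%:Z) = om k.+1 by rewrite /increment lmE lmE'.
have {}bmE : bm = D^-1 * \sum_(k < S) (om k.+1 + (b k.+1 - b k)).
  by rewrite bmE; congr (_ * _); apply: eq_bigr => k _; rewrite incE lmE lmE'.
have t1 : 0 <= 2 * (4 * B + 2 * (`|W| + 1)) / dl.
  by rewrite divr_ge0 ?(ltW dl0)// mulr_ge0// addr_ge0 ?mulr_ge0// addr_ge0.
have t2 : 0 <= 5 * (2 * q%:R + 1) / zeta.
  by rewrite divr_ge0 ?(ltW zeta0)// mulr_ge0// addr_ge0// mulr_ge0.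
have D2 : 2 <= D by apply: le_trans DX; rewrite /X; lra.
have D0 : 0 < D by lra.
have D3 : (4 * B + 2 * (`|W| + 1)) / D <= dl / 2.
  rewrite ler_pdivrMr// mulrC; have : 2 * (4 * B + 2 * (`|W| + 1)) / dl <= D.
    by apply: le_trans DX; rewrite /X; lra.
  by rewrite ler_pdivrMr//; lra.
have D4 : (2 * q%:R + 1) / D <= zeta / 5.
  rewrite ler_pdivrMr// mulrC; have : 5 * (2 * q%:R + 1) / zeta <= D.
    by apply: le_trans DX; rewrite /X; lra.
  by rewrite ler_pdivrMr//; lra.
have bmW1 : `|bm| <= `|W| + 1.
  rewrite (_ : bm = W + (bm - W)); last by ring.
  by apply: le_trans (ler_normD _ _) _; rewrite lerD2l (le_trans bmW).
have omdl k : (k < S)%N -> `|om k.+1 - bm| <= dl.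
  move=> kS; rewrite bmE.
  apply: le_trans (block_increment_dist N_gt0' e0 C0 D2 SD _ _ kS) _.
  - by move=> j; exact: hB.
  - move=> j jS; rewrite -!incE (_ : a + j.+1%:Z = a + j%:Z + 1); last by rewrite intS; ring.
    apply: reg; rewrite sE /=; apply/mapP; exists j => //.
    by rewrite mem_iota add0n leq0n /= ltnW.
  rewrite -/D -bmE.
  have : (4 * B + 2 * `|bm|) / D <= (4 * B + 2 * (`|W| + 1)) / D.
    by rewrite ler_wpM2r ?invr_ge0 ?(ltW D0)// lerD2l ler_wpM2l.
  have : 10 * C * e <= dl / 2 by move: eC e0 C0; nra.
  lra.
have omM k : (k < S)%N -> `|om k.+1| <= `|W| + 2.
  move=> kS; rewrite (_ : om k.+1 = bm + (om k.+1 - bm)); last by ring.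
  by apply: le_trans (ler_normD _ _) _; have := omdl k kS; lra.
have bmM : `|bm| <= `|W| + 2 by lra.
have -> : block_avg N x e (fun i => mu K (increment (lam N) i) (lam N i) n) =
    D^-1 * \sum_(k < S) mu K (om k.+1) (lm k.+1) n.
  by rewrite /block_avg sumS -/D; congr (_ * _); apply: eq_bigr => k _; rewrite incE lmE.
apply: le_trans (block_mu_dist Cm0 hC hL n D2 SD q0 cpq hqp (fun k => erefl)
  bmM omM omdl (ltW dl0) bmW) _.
have u1 : 2 * dl + 2 * (q%:R^-1 + q%:R * (dl + dl) + zeta / 10) + (2 * q%:R + 1) / D <= zeta.
  by move: iq D4 dlq; move: (q%:R^-1) ((2 * q%:R + 1) / D) => r s *; nra.
rewrite mulrAC ler_wpM2r ?expR_ge0//.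
apply: (@le_trans _ _ (Cm * zeta)); first by rewrite ler_wpM2l.
by rewrite /zeta mulrCA ler_piMr ?(ltW z0)// ler_pdivrMr// mul1r lerDl.
Unshelve. all: by end_near. Qed.

End Scales.

Theorem proposition6p6 (R : realType) (K : R) (K_gt0 : 0 < K)
    (t : R) (t_gt0 : 0 < t)
    (d : nat -> measure_display) (Om : forall N : nat, measurableType (d N))
    (P : forall N : nat, probability (Om N) R)
    (w : R -> forall N : nat, int -> Om N -> int)
    (lam : R -> nat -> int -> R)
    (wlim : R -> R -> R)
    (w_periodic : forall N : nat, (0 < N)%N -> lattice_periodic N (w t N))
    (w_measurable : forall (N : nat) (i n : int), (0 < N)%N ->
      measurable (w t N i @^-1` [set n]))
    (N0 : nat)
    (lam_periodic : forall N : nat, (N0 < N)%N -> lattice_periodic N (lam t N))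
    (law_w : forall N : nat, (N0 < N)%N -> forall i : int, 1 <= i <= N%:Z ->
      forall n : int, P N (w t N i @^-1` [set n]) =
        (mu K (increment (lam t N) i) (lam t N i) n)%:E)
    (increment_reg : forall x : R, 0 <= x <= 1 -> exists C : R,
      (limsup2 (fun N e => ereal_sup
         [set (N%:R * `|increment (lam t N) (i + 1)
                        - increment (lam t N) i|)%:E | i in sites N x e])
       < C%:E)%E)
    (wlim_continuous : {within `[0, 1], continuous (wlim t)})
    (wlim_torus : wlim t 0 = wlim t 1)
    (inner_limit : forall x : R, 0 <= x <= 1 ->
      \forall e \near 0^'+, cvgn (fun N => block_mean (P N) N (w t N) x e))
    (outer_limit : forall x : R, 0 <= x <= 1 ->
      limn (fun N => block_mean (P N) N (w t N) x e) @[e --> 0^'+] --> wlim t x)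
    (x : R) (x01 : 0 <= x <= 1) (wx_irr : irrational (wlim t x)) :
  (exists C : nat -> R -> R,
     vanishes (fun N e => (C N e)%:E) /\
     forall (N : nat) (e : R), (N0 < N)%N -> 0 < e -> forall n : int,
       `| block_avg N x e
            (fun i => mu K (increment (lam t N) i) (lam t N i) n)
          - mu_inf K (block_mean (P N) N (w t N) x e) n |
       <= C N e * expR (- K * n%:~R ^+ 2 / 3)) /\
  (forall f : int -> R, L1_gauss_third K f ->
     vanishes (fun N e =>
       ('E_(P N)[fun om => block_avg N x e (fun i => f (w t N i om))]
        - mu_inf_mean K f (block_mean (P N) N (w t N) x e))%E)).
Proof.
have mw N i n : (N0 < N)%N -> measurable (w t N i @^-1` [set n]).
  by move=> NN0; apply: w_measurable; exact: leq_ltn_trans NN0.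
have law N i n : (N0 < N)%N -> P N (w t N i @^-1` [set n]) =
    (mu K (increment (lam t N) i) (lam t N i) n)%:E.
  move=> NN0; have N_gt0 : (0 < N)%N by exact: leq_ltn_trans NN0.
  have [r [z [-> r1N]]] := lattice_window i N_gt0.
  have lE j : lam t N (j + z * N%:Z) = lam t N j.
    exact/lattice_periodic_mul/lam_periodic.
  rewrite lattice_periodic_mul; last exact: w_periodic.
  by rewrite /increment addrAC !lE law_w.
have mean_near := iterated_limit_near (inner_limit x x01) (outer_limit x x01).
have [C hC] := increment_reg x x01.
have reg_near : \forall e \near (0:R)^'+, \forall N \near \oo,
  forall i, sites N x e i ->
    N%:R * `|increment (lam t N) (i + 1) - increment (lam t N) i| <= Num.max C 0.
  apply: filterS (limsup2_lt_near hC) => e; apply: filterS => N hN i si.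
  rewrite le_max -lee_fin; apply/orP; left; apply/ltW/le_lt_trans/hN.
  by apply: ereal_sup_ubound; exists i.
have C0 : 0 <= Num.max C 0 by rewrite le_max lexx orbT.
pose err := pmf_error K d Om P (w t) (lam t) x.
have err_near := pmf_error_near K d Om P (w t) (lam t) N0 x _ K_gt0 mw law wx_irr mean_near _ C0 reg_near.
have err_bounded := pmf_error_bounded K d Om P (w t) (lam t) N0 x K_gt0.
pose g (n : int) : R := expR (- K * n%:~R ^+ 2 / 3).
have g0 n : 0 < g n by exact: expR_gt0.
(* the best constant for given N and e *)
pose ratio N e : set R := range (fun n => `|err N e n| / g n).
pose Csup N e := sup (ratio N e).
have Csup_ub N e n : (N0 < N)%N -> 0 < e -> `|err N e n| <= Csup N e * g n.
  move=> NN0 e0; rewrite -ler_pdivrMr//; apply: ub_le_sup; last by exists n.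
  have [c hc] := err_bounded N e NN0 e0.
  by exists c => _ [m _ <-]; rewrite ler_pdivrMr// hc.
have Csup_ge0 N e : (N0 < N)%N -> 0 < e -> 0 <= Csup N e.
  move=> NN0 e0; rewrite -(pmulr_lge0 _ (g0 0)).
  exact: le_trans (Csup_ub _ _ _ NN0 e0).
have Csup_near z : 0 < z ->
    \forall e \near 0^'+, \forall N \near \oo, [/\ (N0 < N)%N, 0 < e & `|Csup N e| <= z].
  move=> z0; near=> e.
  have e0 : 0 < e by near: e; exact: nbhs_right_gt.
  have hN : \forall N \near \oo, forall n, `|err N e n| <= z * g n by near: e; exact: err_near.
  near=> N.
  have NN0 : (N0 < N)%N by near: N; exact: nbhs_infty_gt.
  split => //; rewrite ger0_norm ?Csup_ge0//; apply: ge_sup; first by exists (`|err N e 0| / g 0), 0.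
  by move=> _ [n _ <-]; rewrite ler_pdivrMr//; move: n; near: N.
split.
  exists Csup; split; last by move=> N e NN0 e0 n; exact: Csup_ub.
  apply: near_vanishes => z z0; apply: filterS (Csup_near z z0) => e.
  by apply: filterS => N [_ _]; rewrite lee_fin.
move=> f /(L1_zfin K_gt0) ff.
set A := zsum (fun n => `|f n| * g n).
have A0 : 0 <= A by apply: zsum_ge0 => n; rewrite mulr_ge0// ltW.
have A1 : 0 < 2 * A + 1 by rewrite ltr_wpDl// mulr_ge0.
apply: near_vanishes => z z0.
apply: filterS (Csup_near _ (divr_gt0 z0 A1)) => e; apply: filterS => N [NN0 e0 CN].
have N_gt0 : (0 < N)%N by exact: leq_ltn_trans NN0.
have [a [S [_ _ sumS]]] := sites_interval x N_gt0 e0.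
apply: le_trans (block_expectation_dist K_gt0 (fun i n => mw N i n NN0) (fun i n => law N i n NN0)
  sumS (ltW e0) ff (Csup_ge0 _ _ NN0 e0) (fun n => Csup_ub _ _ n NN0 e0)) _.
rewrite lee_fin -/A; rewrite ger0_norm ?Csup_ge0// ler_pdivlMr// in CN.
apply: le_trans CN; rewrite (_ : 2 * _ * A = Csup N e * (2 * A)); last by ring.
by rewrite ler_wpM2l ?Csup_ge0// lerDl.
Unshelve. all: by end_near. Qed.
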